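(* Let $p$ be a prime and $n\ge1$. Let $L$ be an irreducible representation of $Y(\mathfrak{gl}_n)$ over $\overline{\mathbb{F}}_p$ which, as a $\mathfrak{gl}_n$-representation (via $E_{ij}\mapsto t_{ij}^{(1)}$), is isomorphic to $V(\mu^{(1)},p)\oplus\dots\oplus V(\mu^{(k)},p)$ with dominant integral weights $\mu^{(j)}$, where $p>\max_j(\mu^{(j)}_1-\mu^{(j)}_n)+n$, and let $\lambda(u)=(\lambda_1(u),\dots,\lambda_n(u))$ be such that $L\cong L(\lambda(u),p)$. Then there are monic polynomials $P_1(u),\dots,P_{n-1}(u)\in\overline{\mathbb{F}}_p[u]$ such that $\frac{\lambda_i(u)}{\lambda_{i+1}(u)}=\frac{P_i(u+1)}{P_i(u)}$ for $i=1,\dots,n-1$.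
   Context: $Y(\mathfrak{gl}_n)$ over $\overline{\mathbb{F}}_p$ is generated by $t_{ij}^{(r)}$, $1\le i,j\le n$, $r\ge1$, with relations $[t_{ij}^{(r+1)},t_{kl}^{(s)}]-[t_{ij}^{(r)},t_{kl}^{(s+1)}]=t_{kj}^{(r)}t_{il}^{(s)}-t_{kj}^{(s)}t_{il}^{(r)}$, $t_{ij}^{(0)}=\delta_{ij}$; $t_{ij}(u)=\delta_{ij}+\sum_{r\ge1}t_{ij}^{(r)}u^{-r}$. For $\lambda_i(u)\in1+u^{-1}\overline{\mathbb{F}}_p[[u^{-1}]]$, $L(\lambda(u),p)$ is the irreducible quotient of the Verma module generated by $\xi$ with $t_{ij}(u)\xi=0$ for $i<j$ and $t_{ii}(u)\xi=\lambda_i(u)\xi$. For a dominant integral weight $\mu$, the Weyl module $V(\mu,p)$ is the quotient of the $\mathfrak{gl}_n$-Verma module $M(\mu,p)$ with highest weight vector $v$ by the submodule generated by $f_i^{\mu_i-\mu_{i+1}+1}v$, $1\le i\le n-1$. *)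

(* Defs.v *)
From HB Require Import structures.
From mathcomp Require Import all_boot all_order all_algebra.
Set Implicit Arguments. Unset Strict Implicit. Unset Printing Implicit Defensive.
Import Order.TTheory GRing.Theory Num.Theory.
Local Open Scope ring_scope.

(* Finite-dimensional modules are F^d, i.e. column vectors 'cV[F]_d;
   an operator is a matrix acting by A *m v. A subspace W of F^d is
   represented as the column space of a matrix U : 'M_(d, m). *)

Definition colsub (F : fieldType) (d m1 m2 : nat)
  (A : 'M[F]_(d, m1)) (B : 'M[F]_(d, m2)) : Prop := ((A^T) <= (B^T))%MS.

Definition tY (F : fieldType) (n d : nat) (T : 'I_n -> 'I_n -> nat -> 'M[F]_d)
  (i j : 'I_n) (r : nat) : 'M[F]_d :=
  if r is 0 then (i == j)%:R%:M else T i j r.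

(* T i j r (r >= 1) are the images of the generators t_{ij}^{(r)} of Y(gl_n):
   the defining relations hold. *)
Definition is_Yrep (F : fieldType) (n d : nat) (T : 'I_n -> 'I_n -> nat -> 'M[F]_d) : Prop :=
  forall (i j k l : 'I_n) (r s : nat),
    (tY T i j r.+1 *m tY T k l s - tY T k l s *m tY T i j r.+1)
    - (tY T i j r *m tY T k l s.+1 - tY T k l s.+1 *m tY T i j r)
    = tY T k j r *m tY T i l s - tY T k j s *m tY T i l r.

Definition Yirreducible (F : fieldType) (n d : nat) (T : 'I_n -> 'I_n -> nat -> 'M[F]_d) : Prop :=
  (0 < d)%N /\
  forall U : 'M[F]_d, (forall (i j : 'I_n) (r : nat), colsub (T i j r.+1 *m U) U) ->
    \rank U = 0%N \/ \rank U = d.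

(* F^d has a highest weight vector xi of weight lam(u):
   t_{ij}(u) xi = 0 (i < j), t_{ii}(u) xi = lam_i(u) xi,
   where lam i r is the coefficient of u^{-r} in lam_i(u). *)
Definition Yhw_vector (F : fieldType) (n d : nat) (T : 'I_n -> 'I_n -> nat -> 'M[F]_d)
  (lam : 'I_n -> nat -> F) (xi : 'cV[F]_d) : Prop :=
  xi != 0 /\
  forall r : nat,
    (forall i j : 'I_n, (i < j)%N -> T i j r.+1 *m xi = 0) /\
    (forall i : 'I_n, T i i r.+1 *m xi = lam i r.+1 *: xi).

Definition is_glrep (F : fieldType) (n d : nat) (E : 'I_n -> 'I_n -> 'M[F]_d) : Prop :=
  forall i j k l : 'I_n,
    E i j *m E k l - E k l *m E i j = (j == k)%:R *: E i l - (l == i)%:R *: E k j.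

Definition glinvariant (F : fieldType) (n d m : nat) (E : 'I_n -> 'I_n -> 'M[F]_d)
  (U : 'M[F]_(d, m)) : Prop := forall i j : 'I_n, colsub (E i j *m U) U.

Definition weyl_gen_rel (F : fieldType) (n d : nat) (E : 'I_n -> 'I_n -> 'M[F]_d)
  (mu : 'I_n -> int) (v : 'cV[F]_d) : Prop :=
  (forall i j : 'I_n, (i < j)%N -> E i j *m v = 0) /\
  (forall i : 'I_n, E i i *m v = (mu i)%:~R *: v) /\
  (forall i j : 'I_n, val j = (val i).+1 ->
     iter (absz (mu i - mu j + 1)) (mulmx (E j i)) v = 0).

(* The gl_n-submodule W = colspace U of F^d is isomorphic to the Weyl module
   V(mu,p) = M(mu,p) / <f_i^{mu_i-mu_{i+1}+1} v>: it is generated by a vector v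
   satisfying the defining relations, and it has the universal property of the
   module presented by these generators and relations (with respect to
   finite-dimensional gl_n-modules). *)
Definition is_weyl_sub (F : fieldType) (n d : nat) (E : 'I_n -> 'I_n -> 'M[F]_d)
  (U : 'M[F]_d) (mu : 'I_n -> int) : Prop :=
  exists v : 'cV[F]_d,
    [/\ colsub v U,
        weyl_gen_rel E mu v,
        (forall U' : 'M[F]_d, glinvariant E U' -> colsub v U' -> colsub U U') &
        (forall (d' : nat) (A : 'I_n -> 'I_n -> 'M[F]_d') (w : 'cV[F]_d'),
           is_glrep A -> weyl_gen_rel A mu w ->
           exists Phi : 'M[F]_(d', d),
             Phi *m v = w /\
             forall i j : 'I_n, Phi *m E i j *m U = A i j *m Phi *m U)].

(* Coefficient of u^e in the Laurent series lam(u) * P(u), where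
   lam(u) = sum_r lam r u^{-r} and P(u) = sum_k P`_k u^k. *)
Definition lser_poly_coef (F : fieldType) (lam : nat -> F) (P : {poly F}) (e : int) : F :=
  \sum_(k < size P | (e <= (k : nat)%:Z)) P`_k * lam (absz ((k : nat)%:Z - e)).

(* Main.v *)
(** Since the representation is finite dimensional, the tuples of operators
(t_ij^(r+1))_(i,j), r >= 0, satisfy a linear recurrence with some characteristic
polynomial q.  The polynomial part of q(u) t_ij(u) is then an operator-valued
polynomial Th_ij(u) satisfying the RTT relation, which can be evaluated at the
points of F.  Comparing with t_kl(v) in the mixed relation and setting v = u gives
lambda_i(u) / lambda_j(u) = theta_i(u) / theta_j(u), where theta_i is the
eigenvalue of Th_ii on the highest weight vector.

By Hilbert 90 for u -> u + 1, the ratio theta_i / theta_j has the form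
P(u+1) / P(u) as soon as theta_i and theta_j have the same norm
prod_(k < p) theta(u - k).  In characteristic p the product
prod_(k < p) Th_11(u - k) is central, hence is the scalar prod_(k < p) theta_1(u - k).
On the Weyl modules at hand the bound on p gives E_1j^(p-2) = E_j1^(p-2) = 0, so
truncated exponentials of these root vectors conjugate Th_11 into Th_jj + Th_1j,
which acts on the highest weight vector as theta_j; thus all norms agree. *)
Require Import Defs.
From HB Require Import structures.
From mathcomp Require Import all_boot all_order all_algebra.
From mathcomp Require Import ring zify.
From Stdlib Require Import Classical.
Set Implicit Arguments. Unset Strict Implicit. Unset Printing Implicit Defensive.
(* [Defs] is imported again because [matrix] has its own [colsub]. *)
Import Order.TTheory GRing.Theory Num.Theory Defs.
Local Open Scope ring_scope.

(** * Linear identities in abelian groups *)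

(** Reflection for identities that use only the additive structure: noncommutative products and
    scalings become atoms, and two sides agree once the integer coefficients of every atom agree. *)
Inductive zexpr := ZVar of nat | ZAdd of zexpr & zexpr | ZOpp of zexpr | ZZero.

Fixpoint zeval (V : zmodType) (env : seq V) (e : zexpr) : V :=
  match e with
  | ZVar i => nth 0 env i
  | ZAdd e1 e2 => zeval env e1 + zeval env e2
  | ZOpp e1 => - zeval env e1
  | ZZero => 0
  end.

Fixpoint zcoef (e : zexpr) (i : nat) : int :=
  match e with
  | ZVar j => (j == i)%:Z
  | ZAdd e1 e2 => zcoef e1 i + zcoef e2 i
  | ZOpp e1 => - zcoef e1 i
  | ZZero => 0
  end.

Lemma zevalE (V : zmodType) (env : seq V) e :
  zeval env e = \sum_(i < size env) nth 0 env i *~ zcoef e i.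
Proof.
elim: e => [j|e1 IH1 e2 IH2|e IH|] /=.
- have [lt_j|le_j] := ltnP j (size env); last first.
    rewrite nth_default // big1 // => i _.
    by rewrite gtn_eqF ?mulr0z // (leq_trans (ltn_ord i) le_j).
  rewrite (bigD1 (Ordinal lt_j)) //= eqxx mulr1z big1 ?addr0 // => i ne_ij.
  by rewrite eq_sym (_ : (_ == _) = false) ?mulr0z //; apply: negbTE.
- by rewrite IH1 IH2 -big_split; apply: eq_bigr => i _; rewrite mulrzDr.
- by rewrite IH -sumrN; apply: eq_bigr => i _; rewrite mulrNz.
- by rewrite big1.
Qed.

Lemma zeval_eq (V : zmodType) (env : seq V) e1 e2 :
  all (fun i => zcoef e1 i == zcoef e2 i) (iota 0 (size env)) ->
  zeval env e1 = zeval env e2.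
Proof.
move=> /allP h; rewrite !zevalE; apply: eq_bigr => i _.
by have /eqP -> : zcoef e1 i == zcoef e2 i by apply: h; rewrite mem_iota /= add0n.
Qed.

(* Atoms are compared up to conversion, since equal terms may carry different
   paths of canonical structures. *)
Ltac zindex x env :=
  match env with
  | ?y :: ?env' =>
    match goal with
    | _ => let _ := match goal with _ => unify x y end in constr:(O)
    | _ => let i := zindex x env' in constr:(S i)
    end
  end.
Ltac zatoms env e :=
  match e with
  | (?a + ?b)%R => let env1 := zatoms env a in zatoms env1 b
  | (- ?a)%R => zatoms env a
  | 0%R => env
  | _ => match goal with
         | _ => let _ := zindex e env in env
         | _ => constr:(e :: env)
         end
  end.
Ltac zquote env e :=
  match e with
  | (?a + ?b)%R => let x := zquote env a in let y := zquote env b in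
                   constr:(ZAdd x y)
  | (- ?a)%R => let x := zquote env a in constr:(ZOpp x)
  | 0%R => constr:(ZZero)
  | _ => let i := zindex e env in constr:(ZVar i)
  end.
Ltac zmod :=
  match goal with
  | |- @eq ?V ?x ?y =>
    let env0 := zatoms (@nil V) x in
    let env := zatoms env0 y in
    let ex := zquote env x in
    let ey := zquote env y in
    refine (@zeval_eq _ env ex ey _); vm_compute; reflexivity
  end.

(** * Polynomial currents and the central product *)

Lemma drop_poly_recl (F : fieldType) (q : {poly F}) (r : nat) (a : F) :
  (drop_poly r q).[a] = (q`_r) + a * (drop_poly r.+1 q).[a].
Proof.
have -> : drop_poly r q = (q`_r)%:P + 'X * drop_poly r.+1 q.
  apply/polyP=> i; rewrite coefD coefC coefXM !coef_drop_poly.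
  by case: i => [|i] /=; rewrite ?addr0 ?add0r // addSnnS.
by rewrite !hornerE.
Qed.

Definition yangian_rel (R : pzRingType) (I : eqType) (t : I -> I -> nat -> R) :=
  forall i j k l r s,
    (t i j r.+1 * t k l s - t k l s * t i j r.+1)
    - (t i j r * t k l s.+1 - t k l s.+1 * t i j r)
    = t k j r * t i l s - t k j s * t i l r.

(** For commuting values and [k = p] this is the norm under translation by the prime field; in
    general the factor at [a] stands leftmost. *)
Fixpoint shift_prod (F R : pzRingType) (W : F -> R) (a : F) (k : nat) : R :=
  if k is k'.+1 then W a * shift_prod W (a - 1) k' else 1.

Section PolynomialCurrents.
Variables (F : fieldType) (R : algType F) (I : eqType) (t : I -> I -> nat -> R).
Hypothesis t0 : forall i j, t i j 0 = (i == j)%:R.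
Hypothesis yrel : yangian_rel t.
Variable q : {poly F}.
Hypothesis q_rel : forall i j, \sum_(r < size q) q`_r *: t i j r.+1 = 0.

(** In q(u) t_ij(u), the nonnegative powers of u that multiply t_ij^(r) add up to [drop_poly r q];
    this is the polynomial part at u = a. *)
Definition current i j (a : F) : R :=
  \sum_(r < size q) (drop_poly r q).[a] *: t i j r.

Local Notation Th := current.

Lemma t0_comm i j x : t i j 0 * x = x * t i j 0.
Proof. by rewrite t0; case: eqP => _; rewrite ?mul1r ?mulr1 ?mul0r ?mulr0. Qed.

(** Combines Horner's rule for the quotients [drop_poly r q] with [q_rel], which says that q(u)
    t_ij(u) has no u^(-1) term. Raising the index r thus amounts to multiplying by [a], up to a
    scalar that drops out of commutators. *)
Lemma current_shift i j a :
  \sum_(r < size q) (drop_poly r q).[a] *: t i j r.+1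
  = a *: Th i j a - (a * q.[a]) *: t i j 0.
Proof.
have hN : Th i j a = \sum_(r < (size q).+1) (drop_poly r q).[a] *: t i j r.
  by rewrite big_ord_recr /= drop_poly_eq0 // horner0 scale0r addr0.
rewrite hN big_ord_recl /= drop_poly0l scalerDr scalerA addrC addKr scaler_sumr.
under eq_bigr do rewrite drop_poly_recl scalerDl.
rewrite big_split /= q_rel add0r; apply: eq_bigr => r _.
by rewrite scalerA.
Qed.

Lemma current_mixed i j k l s a :
  a *: (Th i j a * t k l s - t k l s * Th i j a)
  - (Th i j a * t k l s.+1 - t k l s.+1 * Th i j a)
  = Th k j a * t i l s - t k j s * Th i l a.
Proof.
have -> : a *: (Th i j a * t k l s - t k l s * Th i j a) =
   (\sum_(r < size q) (drop_poly r q).[a] *: t i j r.+1) * t k l s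
   - t k l s * (\sum_(r < size q) (drop_poly r q).[a] *: t i j r.+1).
  rewrite current_shift mulrBl mulrBr -!scalerAl -!scalerAr t0_comm scalerBr.
  zmod.
rewrite /current !mulr_suml !mulr_sumr -!sumrB; apply: eq_bigr => r _.
by rewrite -!scalerAl -!scalerAr -!scalerBr yrel.
Qed.

Lemma current_rtt i j k l a b :
  (a - b) *: (Th i j a * Th k l b - Th k l b * Th i j a)
  = Th k j a * Th i l b - Th k j b * Th i l a.
Proof.
have -> : (a - b) *: (Th i j a * Th k l b - Th k l b * Th i j a)
  = a *: (Th i j a * Th k l b - Th k l b * Th i j a)
    - (Th i j a * (\sum_(r < size q) (drop_poly r q).[b] *: t k l r.+1)
       - (\sum_(r < size q) (drop_poly r q).[b] *: t k l r.+1) * Th i j a).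
  rewrite current_shift mulrBl mulrBr -!scalerAl -!scalerAr t0_comm.
  rewrite scalerBl !scalerBr; zmod.
have := fun s => current_mixed i j k l s a.
move: (Th i j a) (Th k j a) (Th i l a) => X Y W mixed.
rewrite /current !mulr_suml !mulr_sumr -!sumrB scaler_sumr -!sumrB.
apply: eq_bigr => r _.
rewrite -!scalerAl -!scalerAr -!scalerBr scalerA mulrC -scalerA -scalerBr.
by rewrite mixed.
Qed.

Lemma current_gl i j k l a :
  t i j 1 * Th k l a - Th k l a * t i j 1
  = (k == j)%:R * Th i l a - (i == l)%:R * Th k j a.
Proof.
rewrite /current !mulr_suml !mulr_sumr -!sumrB; apply: eq_bigr => r _.
rewrite -!scalerAl -!scalerAr -!scalerBr; congr (_ *: _).
have := yrel i j k l 0 r; rewrite (t0_comm i j) subrr subr0 => ->.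
by rewrite !t0; congr (_ - _); case: (i == l); rewrite ?mul1r ?mulr1 ?mul0r ?mulr0.
Qed.

(** For equal indices the right side of the mixed relation is the commutator itself, so the
    commutator at s+1 is a - 1 times the one at s. *)
Lemma current_t_diag i a s : Th i i a * t i i s = t i i s * Th i i a.
Proof.
elim: s => [|s IH]; first by rewrite t0_comm.
have := current_mixed i i i i s a; rewrite -IH !subrr scaler0 sub0r => /eqP.
by rewrite oppr_eq0 subr_eq0 => /eqP.
Qed.

Lemma current_diag_comm i a b : Th i i a * Th i i b = Th i i b * Th i i a.
Proof.
rewrite {2 3}/current mulr_suml mulr_sumr; apply: eq_bigr => r _.
by rewrite -scalerAl -scalerAr current_t_diag.
Qed.

Local Notation falling i := (shift_prod (Th i i)).

Lemma falling_comm i a b k : Th i i a * falling i b k = falling i b k * Th i i a.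
Proof.
elim: k b => [|k IH] b /=; first by rewrite mul1r mulr1.
by rewrite mulrA current_diag_comm -!mulrA IH.
Qed.

Lemma falling_recr i a k :
  falling i a k.+1 = Th i i (a - k%:R) * falling i a k.
Proof.
elim: k a => [|k IH] a; first by rewrite /= subr0.
have -> : falling i a k.+2 = Th i i a * falling i (a - 1) k.+1 by [].
rewrite IH mulrA current_diag_comm -mulrA; congr (Th i i _ * _).
by rewrite -addrA -opprD -[1]/(1%:R) -natrD.
Qed.

(** This is the RTT relation at the points a - k and a, whose difference supplies the coefficient k;
    the remaining factors of the product are common to all terms. *)
Lemma exchange_unwanted i l k a :
  Th i l a * falling i (a - 1) k
  + k%:R *: (Th i i a * (Th i l (a - 1 - k%:R + 1) * falling i (a - 1) k.-1))
  = k.+1%:R *: (Th i l (a - k%:R) * falling i a k).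
Proof.
have -> : a - 1 - k%:R + 1 = a - k%:R by ring.
case: k => [|k]; first by rewrite scale0r addr0 subr0 scale1r /=.
rewrite falling_recr.
have -> : a - 1 - k%:R = a - k.+1%:R. by rewrite -[k.+1%:R]natr1; ring.
rewrite /=; set b := a - k.+1%:R; set K := falling i (a - 1) k.
have /= := current_rtt i l i i b a.
have -> : b - a = - k.+1%:R by rewrite /b addrC addKr.
move=> h; rewrite !mulrA 2!(scalerAl _ (_ * _) K) -mulrDl; congr (_ * K).
rewrite -[k.+2%:R]natr1 scalerDl scale1r; move: h; rewrite scaleNr scalerBr.
set X := Th i l a * _; set Y := k.+1%:R *: (Th i i a * _) => h.
have -> : X = Th i l b * Th i i a - (Th i l b * Th i i a - X) by zmod.
rewrite -h; zmod.
Qed.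

(* The exchange relation for moving t i l through the product; the unwanted
   term carries the factor k, which vanishes at k = p in characteristic p. *)
Lemma falling_exchange i l k a s :
  (a - k%:R) *: (falling i a k * t i l s) - falling i a k * t i l s.+1
  = a *: (t i l s * falling i a k) - t i l s.+1 * falling i a k
    - k%:R *: (t i i s * (Th i l (a - k%:R + 1) * falling i a k.-1)).
Proof.
elim: k a => [|k IH] a.
  by rewrite subr0 scale0r subr0 /= !mul1r !mulr1.
have E1 : (a - 1) *: (Th i i a * t i l s) - Th i i a * t i l s.+1
          = a *: (t i l s * Th i i a) - t i l s.+1 * Th i i a
            - t i i s * Th i l a.
  have := current_mixed i i i l s a.
  rewrite scalerBr scalerBl scale1r => h.
  have {h} := congr1 (fun x => x + t i i s * Th i l a) h; rewrite subrK.
  move: (a *: (Th i i a * t i l s)) => X <-; zmod.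
have -> : a - k.+1%:R = a - 1 - k%:R by rewrite -[k.+1%:R]natr1; ring.
have -> : falling i a k.+1 = Th i i a * falling i (a - 1) k by [].
rewrite [k.+1.-1]/=.
have /(congr1 (fun x => Th i i a * x)) := IH (a - 1).
rewrite !mulrBr -!scalerAr ![Th i i a * (falling _ _ _ * _)]mulrA => ->.
rewrite !mulrA scalerAl -mulrBl E1 !mulrBl -!scalerAl.
(* One unwanted term comes from [E1], the other from the induction hypothesis; they merge into a
   single one with coefficient k+1. *)
have := exchange_unwanted i l k a.
have -> : a - 1 - k%:R + 1 = a - k%:R by ring.
move=> /(congr1 (fun x => t i i s * x)); rewrite mulrDr -!scalerAr !mulrA => <-.
rewrite current_t_diag.
zmod.
Qed.

End PolynomialCurrents.

Local Notation falling t q i := (shift_prod (current t q i i)).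

(** * Centrality of the p-fold shifted product *)

Section Central.
Variables (F : fieldType) (R : algType F) (I : eqType) (t : I -> I -> nat -> R).
Hypothesis t0 : forall i j, t i j 0 = (i == j)%:R.
Hypothesis yrel : yangian_rel t.
Variables (q : {poly F}) (p : nat).
Hypothesis q_rel : forall i j, \sum_(r < size q) q`_r *: t i j r.+1 = 0.
Hypothesis char_p : p \in [pchar F].

(** At k = p the exchange relation says that the commutator at s+1 is [a] times the one at s; the
    induction starts from t_il^(0) = 0. *)
Lemma falling_comm_row i l a s : i != l ->
  falling t q i a p * t i l s = t i l s * falling t q i a p.
Proof.
move=> ne_il; elim: s => [|s IH].
  by rewrite t0 (negbTE ne_il) mulr0 mul0r.
have := falling_exchange t0 yrel q_rel i l p a s.
by rewrite pcharf0 // scale0r !subr0 IH => /addrI/oppr_inj.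
Qed.

Lemma falling_comm_diag i a s :
  falling t q i a p * t i i s = t i i s * falling t q i a p.
Proof.
elim: p a => [|k IH] a /=; first by rewrite mul1r mulr1.
by rewrite -mulrA IH !mulrA (current_t_diag t0 yrel q_rel).
Qed.

(** Row and column i suffice: every other t_kl^(s) is recovered from the commutator of t_ki^(1) and
    t_il^(s). *)
Lemma falling_central_of_col i a :
  (forall l s, i != l -> falling t q i a p * t l i s = t l i s * falling t q i a p) ->
  forall k l s, falling t q i a p * t k l s = t k l s * falling t q i a p.
Proof.
move=> col k l s.
have [->|ne_ik] := eqVneq k i.
  have [->|ne_il] := eqVneq l i; first exact: falling_comm_diag.
  by apply: falling_comm_row; rewrite eq_sym.
have [->|ne_il] := eqVneq l i; first by apply: col; rewrite eq_sym.
have hkl : t k l s = t k i 1 * t i l s - t i l s * t k i 1 + t i i s * t k l 0.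
  have := yrel k i i l 0 s; rewrite (t0_comm t0 k i) subrr subr0 => ->.
  by rewrite (t0 i i) eqxx mul1r subrK.
have row s' : falling t q i a p * t i l s' = t i l s' * falling t q i a p.
  by apply: falling_comm_row; rewrite eq_sym.
have cl : falling t q i a p * t k i 1 = t k i 1 * falling t q i a p.
  by apply: col; rewrite eq_sym.
rewrite hkl mulrDr mulrBr mulrDl mulrBl !mulrA row cl falling_comm_diag.
rewrite -!mulrA row cl; congr (_ + _ * _).
by rewrite (t0_comm t0 k l).
Qed.
End Central.

Section MatrixCurrents.
Variables (F : fieldType) (d : nat) (I : eqType) (t : I -> I -> nat -> 'M[F]_d.+1).
Hypothesis t0 : forall i j, t i j 0 = (i == j)%:R.
Hypothesis yrel : yangian_rel t.
Variables (q : {poly F}) (p : nat).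
Hypothesis q_rel : forall i j, \sum_(r < size q) q`_r *: t i j r.+1 = 0.
Hypothesis char_p : p \in [pchar F].

(** Both matrix transposition and t_ij -> t_ji reverse products, so [tT] satisfies the Yangian
    relations again, and commutation with row i for [tT] is commutation with column i for [t]. *)
Let tT i j r : 'M[F]_d.+1 := (t j i r)^T.

Let tT0 i j : tT i j 0 = (i == j)%:R.
Proof. by rewrite /tT t0 eq_sym; case: (i == j); rewrite ?trmx1 ?trmx0. Qed.

Let trmxM (A B : 'M[F]_d.+1) : (A * B)^T = B^T * A^T.
Proof. exact: trmx_mul. Qed.

Let tT_rel : yangian_rel tT.
Proof.
move=> i j k l r s; rewrite /tT -!trmxM.
have /(congr1 (fun x => - x^T)) := yrel j i l k r s.
rewrite !linearB /= => h.
by etransitivity; [|etransitivity; [exact: h|]]; zmod.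
Qed.

Let tT_q_rel i j : \sum_(r < size q) q`_r *: tT i j r.+1 = 0.
Proof.
transitivity ((\sum_(r < size q) q`_r *: t j i r.+1)^T).
  by rewrite linear_sum; apply: eq_bigr => r _; rewrite linearZ.
by rewrite q_rel linear0.
Qed.

Let current_tr i j a : current tT q i j a = (current t q j i a)^T.
Proof.
rewrite /current linear_sum; apply: eq_bigr => r _.
by rewrite linearZ.
Qed.

Let falling_tr i a k : falling tT q i a k = (falling t q i a k)^T.
Proof.
elim: k a => [|k IH] a /=; first by rewrite trmx1.
by rewrite (falling_comm t0 yrel q_rel) trmxM -IH current_tr.
Qed.

Lemma falling_central i k l s a :
  falling t q i a p * t k l s = t k l s * falling t q i a p.
Proof.
apply: falling_central_of_col => // {}l {}s ne_il.
apply: trmx_inj; rewrite !trmxM -falling_tr.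
by have := falling_comm_row tT0 tT_rel tT_q_rel char_p a s ne_il.
Qed.
End MatrixCurrents.

(** * Conjugation by truncated exponentials *)

Section TruncatedExp.
Variables (F : fieldType) (R : algType F) (p : nat).
Hypothesis char_p : p \in [pchar F].

Definition texp (f : R) (r : nat) : R := \sum_(k < r) (k`!%:R)^-1 *: f ^+ k.

Lemma texpS f r : texp f r.+1 = texp f r + (r`!%:R)^-1 *: f ^+ r.
Proof. exact: big_ord_recr. Qed.

Lemma natr_neq0_char k : (0 < k < p)%N -> k%:R != 0 :> F.
Proof.
by move=> /andP[k0 kp]; rewrite -(dvdn_pcharf char_p) gtnNdvd.
Qed.

Lemma fact_neq0_char k : (k < p)%N -> k`!%:R != 0 :> F.
Proof.
elim: k => [|k IH] kp; first by rewrite oner_neq0.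
rewrite factS natrM; apply: mulf_neq0; first exact: natr_neq0_char.
exact/IH/ltnW.
Qed.

(** Leibniz rule for ad f with ad f X = Y, (ad f)^2 X = 2Z and (ad f)^3 X = 0; the binomial
    coefficient times 2 gives the factor of Z. *)
Lemma expr_conj (f X Y Z : R) k :
    f * X = X * f + Y -> f * Y = Y * f + (Z + Z) -> f * Z = Z * f ->
  f ^+ k.+2 * X = X * f ^+ k.+2 + (k.+2%:R : F) *: (Y * f ^+ k.+1)
                  + (k.+2%:R * k.+1%:R : F) *: (Z * f ^+ k).
Proof.
move=> fX fY fZ; elim: k => [|k IH].
  rewrite expr2 -mulrA fX mulrDr mulrA fX fY mulrDl -mulrA expr1 expr0 mulr1 mulr1.
  rewrite !scaler_nat !mulr2n; zmod.
rewrite exprS -mulrA IH.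
have -> : k.+3%:R = k.+2%:R + 1 :> F by rewrite natr1.
have : k.+2%:R = k.+1%:R + 1 :> F by rewrite natr1.
move: (k.+2%:R : F) (k.+1%:R : F) => c2 c1 h.
rewrite !mulrDr -!scalerAr !mulrA fX fY fZ !mulrDl -!mulrA -!exprS mul1r.
rewrite !scalerDl !scalerDr scale1r; set C := Z * _.
have -> : c2 *: C + c2 *: C = (c2 * c1 + c2) *: C - (c2 * c1) *: C + c2 *: C.
  rewrite scalerDl; zmod.
have -> : (c2 * c2) *: C = (c2 * c1 + c2) *: C by congr (_ *: _); rewrite h; ring.
zmod.
Qed.

(** The decreasing truncation lengths make the identity exact without nilpotency of [f]; the bound
    by p keeps all factorials invertible. *)
Lemma texp_conj (f X Y Z : R) r : (r.+2 <= p)%N ->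
    f * X = X * f + Y -> f * Y = Y * f + (Z + Z) -> f * Z = Z * f ->
  texp f r.+2 * X = X * texp f r.+2 + Y * texp f r.+1 + Z * texp f r.
Proof.
move=> rp fX fY fZ; elim: r rp => [|r IH] rp.
  rewrite /texp !big_ord_recr !big_ord0 /= !fact0 !factS !fact0 muln1.
  rewrite !invr1 !scale1r !expr0 expr1 !add0r mulr0 mulrDl mulrDr fX mul1r !mulr1; zmod.
rewrite (texpS f r.+2) mulrDl IH ?(ltnW rp) // -scalerAl (expr_conj r fX fY fZ).
rewrite (texpS f r.+1) (texpS f r) !mulrDr -!scalerAr !scalerDr !scalerA.
have n2 : r.+2%:R != 0 :> F by rewrite natr_neq0_char.
have n1 : r.+1%:R != 0 :> F by apply: natr_neq0_char; apply: (ltnW rp).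
have n0 : r`!%:R != 0 :> F by apply: fact_neq0_char; apply: (ltnW (ltnW rp)).
have -> : (r.+2)`!%:R^-1 * r.+2%:R = (r.+1)`!%:R^-1 :> F.
  rewrite !factS !natrM; move: (r`!%:R : F) (r.+1%:R : F) (r.+2%:R : F) n0 n1 n2.
  by move=> x y z x0 y0 z0; field; rewrite ?x0 ?y0 ?z0.
have -> : (r.+2)`!%:R^-1 * (r.+2%:R * r.+1%:R) = r`!%:R^-1 :> F.
  rewrite !factS !natrM; move: (r`!%:R : F) (r.+1%:R : F) (r.+2%:R : F) n0 n1 n2.
  by move=> x y z x0 y0 z0; field; rewrite ?x0 ?y0 ?z0.
zmod.
Qed.

Lemma texp_rinv f N r : f ^+ N = 0 -> exists g, texp f r.+1 * g = 1.
Proof.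
move=> fN; pose H := \sum_(k < r) ((k.+1)`!%:R)^-1 *: f ^+ k : R.
have fH : GRing.comm f H.
  apply: commr_sum => k _; rewrite /GRing.comm -scalerAr -scalerAl; congr (_ *: _).
  exact: commrX.
have E : texp f r.+1 = 1 + f * H.
  rewrite /texp big_ord_recl fact0 invr1 scale1r expr0; congr (_ + _).
  by rewrite mulr_sumr; apply: eq_bigr => k _; rewrite -scalerAr -exprS.
have yN : (- (f * H)) ^+ N = 0.
  by rewrite exprNn exprMn_comm // fN mul0r mulr0.
exists (\sum_(i < N) (- (f * H)) ^+ i).
have := subrX1 (- (f * H)) N; rewrite yN E.
by rewrite -opprD mulNr sub0r addrC => /oppr_inj.
Qed.
End TruncatedExp.

Lemma shift_prod_conj (F R : pzRingType) (U V : F -> R) (G : R) a k :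
  (forall c, G * U c = V c * G) -> G * shift_prod U a k = shift_prod V a k * G.
Proof.
move=> GUV; elim: k a => [|k IH] a /=; first by rewrite mul1r mulr1.
by rewrite mulrA GUV -mulrA IH mulrA.
Qed.

(** * Conjugation of a diagonal current by root exponentials *)

Section WeylConjugation.
Variables (F : fieldType) (R : algType F) (I : eqType) (t : I -> I -> nat -> R).
Hypothesis t0 : forall i j, t i j 0 = (i == j)%:R.
Hypothesis yrel : yangian_rel t.
Variables (q : {poly F}) (p : nat).
Hypothesis char_p : p \in [pchar F].
Variables (i j : I).
Hypothesis ne_ij : i != j.
Hypothesis p_gt2 : (2 < p)%N.
Hypothesis e_nil : t i j 1 ^+ p.-2 = 0.
Hypothesis f_nil : t j i 1 ^+ p.-2 = 0.
Local Notation Th := (current t q).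

(* exp(-t_ij) and then exp(t_ji) take Th i i to Th i j + Th j j, which acts on
   a vector killed by Th i j in the same way as Th j j. *)
Lemma weyl_conj : exists G G' : R, G * G' = 1 /\
  forall c, G * Th i i c = (Th i j c + Th j j c) * G.
Proof.
have gl := current_gl t0 yrel q.
have comm (x y z : R) : x * y - y * x = z -> x * y = y * x + z.
  by move=> <-; zmod.
have ne_ji : (j == i) = false by rewrite eq_sym (negbTE ne_ij).
have ne_ij' : (i == j) = false by exact: negbTE ne_ij.
(* The truncations of lengths p - 2, p - 1 and p in [texp_conj] coincide, so that one common factor
   can be taken out. *)
have nil (x : R) r : x ^+ p.-2 = 0 -> texp x (p.-2 + r) = texp x p.-2.
  move=> xp; elim: r => [|r IH]; first by rewrite addn0.
  by rewrite addnS texpS IH exprD xp mul0r scaler0 addr0.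
pose G1 := texp (- t i j 1) p; pose G2 := texp (t j i 1) p.
have e_nil' : (- t i j 1) ^+ p.-2 = 0 by rewrite exprNn e_nil mulr0.
have p2 : p = p.-2.+2 by case: p p_gt2 => [|[|]].
have [g1 G1g1] : exists g, G1 * g = 1.
  by rewrite /G1 p2; apply: texp_rinv e_nil'.
have [g2 G2g2] : exists g, G2 * g = 1.
  by rewrite /G2 p2; apply: texp_rinv f_nil.
have G1c c : G1 * Th i i c = (Th i i c + Th i j c) * G1.
  have := @texp_conj _ R _ char_p (- t i j 1) (Th i i c) (Th i j c) 0 p.-2.
  rewrite -p2 => /(_ (leqnn _)).
  have := comm _ _ _ (gl i j i i c); rewrite eqxx ne_ij' mul0r mul1r sub0r => h1.
  have := comm _ _ _ (gl i j i j c); rewrite ne_ij' !mul0r subr0 => h2.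
  have E1 : texp (- t i j 1) p.-2.+1 = G1.
    rewrite /G1; have := nil _ 1 e_nil'; have := nil _ 2 e_nil'.
    by rewrite addn1 addn2 -p2 => -> ->.
  rewrite E1 !addr0 -mulrDl; apply; rewrite ?mulr0 //.
    by rewrite mulNr h1 mulrN; zmod.
  by rewrite mulNr h2 mulrN; zmod.
(* Here ad t_ji does not stop after one step: the second-order term is -Th_ji, and it cancels the
   Th_ji of the first-order term. *)
have G2c c : G2 * (Th i i c + Th i j c) = (Th i j c + Th j j c) * G2.
  have := @texp_conj _ R _ char_p (t j i 1) (Th i i c + Th i j c)
    (Th j i c + Th j j c - Th i i c) (- Th j i c) p.-2.
  rewrite -p2 => /(_ (leqnn _)).
  have := comm _ _ _ (gl j i i i c); have := comm _ _ _ (gl j i i j c).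
  have := comm _ _ _ (gl j i j i c); have := comm _ _ _ (gl j i j j c).
  rewrite !eqxx !ne_ji !mul0r !mul1r => hjj hji hij hii.
  have E1 : texp (t j i 1) p.-2.+1 = G2.
    by rewrite /G2; have := nil _ 1 f_nil; have := nil _ 2 f_nil; rewrite addn1 addn2 -p2 => -> ->.
  have E0 : texp (t j i 1) p.-2 = G2.
    by rewrite /G2; have := nil _ 2 f_nil; rewrite addn2 -p2 => ->.
  rewrite E1 E0 -!mulrDl => ->.
  - by congr (_ * _); zmod.
  - by rewrite mulrDr hij hii mulrDl; zmod.
  - by rewrite !mulrDr !mulrDl mulrN mulNr hii hjj hji; zmod.
  - by rewrite mulrN mulNr hji; zmod.
exists (G2 * G1), (g1 * g2); split; first by rewrite mulrA -(mulrA G2) G1g1 mulr1.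
by move=> c; rewrite -mulrA G1c mulrA G2c mulrA.
Qed.
End WeylConjugation.

(** * Nilpotency on Weyl modules *)

Lemma iter_mulmx (F : fieldType) (d N : nat) (A : 'M[F]_d.+1) (v : 'cV[F]_d.+1) :
  iter N (mulmx A) v = A ^+ N *m v.
Proof.
elim: N => [|N IH] /=; first by rewrite expr0 mul1mx.
by rewrite IH mulmxA exprS.
Qed.

Lemma ltn_ord_eqF n (a b : 'I_n) : (a < b)%N -> ((a == b) = false) * ((b == a) = false).
Proof. by move=> ab; rewrite -!val_eqE /= (ltn_eqF ab) (gtn_eqF ab). Qed.

Section WeylModule.
Variables (F : fieldType) (n d : nat) (E : 'I_n -> 'I_n -> 'M[F]_d.+1).
Hypothesis glE : is_glrep E.
Variables (mu : 'I_n -> int) (v : 'cV[F]_d.+1).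
Hypothesis v_sing : forall i j : 'I_n, (i < j)%N -> E i j *m v = 0.
Hypothesis v_wt : forall i : 'I_n, E i i *m v = (mu i)%:~R *: v.

Lemma gl_act i j k l (x : 'cV[F]_d.+1) :
  E i j *m (E k l *m x) = E k l *m (E i j *m x)
    + (j == k)%:R *: (E i l *m x) - (l == i)%:R *: (E k j *m x).
Proof.
have /(congr1 (fun A => A *m x)) := glE i j k l.
rewrite !mulmxBl -!scalemxAl -!mulmxA => h.
rewrite -[LHS](subrK (E k l *m (E i j *m x))) h; zmod.
Qed.

(* [sub_gen c] is the module generated by [v] over the copy of gl_(n-c) with
   indices at least [c]; [level c k] is the span of the vectors obtained from
   [sub_gen c.+1] by applying [k] of the lowering operators [E j c]. *)
Inductive sub_gen (c : nat) : 'cV[F]_d.+1 -> Prop :=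
| sub_gen_v : sub_gen c v
| sub_gen_comb a x y : sub_gen c x -> sub_gen c y -> sub_gen c (a *: x + y)
| sub_gen_act (a b : 'I_n) x : (c <= a)%N -> (c <= b)%N -> sub_gen c x ->
    sub_gen c (E a b *m x).

Inductive level (c : 'I_n) : nat -> 'cV[F]_d.+1 -> Prop :=
| level0 x : sub_gen c.+1 x -> level c 0 x
| levelS (j : 'I_n) k x : (c < j)%N -> level c k x -> level c k.+1 (E j c *m x)
| level_comb a k x y : level c k x -> level c k y -> level c k (a *: x + y).

Inductive levels (c : 'I_n) : 'cV[F]_d.+1 -> Prop :=
| levels_level k x : level c k x -> levels c x
| levels_add x y : levels c x -> levels c y -> levels c (x + y).

Lemma level_zero c k x : level c k x -> level c k 0.
Proof. by move=> hx; rewrite -(addNr x) -scaleN1r; apply: level_comb. Qed.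

Lemma level_scale c k a x : level c k x -> level c k (a *: x).
Proof.
by move=> hx; rewrite -[_ *: _]addr0; apply: level_comb => //; apply: level_zero hx.
Qed.

Lemma level_add c k x y : level c k x -> level c k y -> level c k (x + y).
Proof. by move=> hx hy; rewrite -[x]scale1r; apply: level_comb. Qed.

Lemma gl_act_comm i j k l (x : 'cV[F]_d.+1) :
  (j == k) = false -> (l == i) = false ->
  E i j *m (E k l *m x) = E k l *m (E i j *m x).
Proof. by move=> jk li; rewrite gl_act jk li !scale0r addr0 subr0. Qed.

Lemma sub_gen_Ecc (c : 'I_n) x : sub_gen c.+1 x -> E c c *m x = (mu c)%:~R *: x.
Proof.
elim=> [|a y z _ IHy _ IHz|a b y ca cb _ IH].
- exact: v_wt.
- by rewrite mulmxDr -scalemxAr IHy IHz scalerDr !scalerA mulrC.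
- by rewrite gl_act_comm ?(ltn_ord_eqF ca, ltn_ord_eqF cb) // IH -scalemxAr.
Qed.

Lemma sub_gen_Ecj (c j : 'I_n) x : (c < j)%N -> sub_gen c.+1 x -> E c j *m x = 0.
Proof.
move=> cj hx; elim: hx j cj => [|a y z _ IHy _ IHz|a b y ca cb _ IH] j cj.
- exact: v_sing.
- by rewrite mulmxDr -scalemxAr IHy // IHz // scaler0 addr0.
- rewrite gl_act (ltn_ord_eqF cb) scale0r subr0 IH // IH // scaler0 addr0.
  by rewrite mulmx0.
Qed.

Lemma level_gl (c a b : 'I_n) k x : (c < a)%N -> (c < b)%N ->
  level c k x -> level c k (E a b *m x).
Proof.
move=> ca cb; elim=> {k x} [x hx|j k x cj hx IH|e k x y _ IHx _ IHy].
- exact/level0/sub_gen_act.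
- rewrite gl_act (ltn_ord_eqF ca) scale0r subr0 addrC.
  by apply: level_comb; apply: levelS.
- by rewrite mulmxDr -scalemxAr; apply: level_comb.
Qed.

Lemma level_Ecc (c : 'I_n) k x : level c k x ->
  E c c *m x = ((mu c)%:~R - k%:R) *: x.
Proof.
elim=> {k x} [x hx|j k x cj hx IH|e k x y _ IHx _ IHy].
- by rewrite subr0 sub_gen_Ecc.
- rewrite gl_act (ltn_ord_eqF cj) eqxx scale0r scale1r addr0 IH -scalemxAr.
  by rewrite -[k.+1%:R]natr1 opprD addrA [in RHS]scalerBl scale1r.
- by rewrite mulmxDr -scalemxAr IHx IHy scalerDr !scalerA mulrC.
Qed.

(** Commuting E_cj past E_ic leaves E_cc, a scalar on each level by [level_Ecc], and E_ij, which
    preserves levels by [level_gl]. *)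
Lemma level_raise (c j : 'I_n) k x : (c < j)%N -> level c k x ->
  if k is k'.+1 then level c k' (E c j *m x) else E c j *m x = 0.
Proof.
move=> cj; elim=> {k x} [x hx|i k x ci hx IH|e k x y _ IHx _ IHy].
- exact: sub_gen_Ecj.
- rewrite gl_act eqxx scale1r -[- (E i j *m x)]scaleN1r.
  apply: level_add; last exact/level_scale/level_gl.
  apply: level_add; last by apply: level_scale; rewrite (level_Ecc hx); apply: level_scale.
  case: k hx IH => [|k] hx IH; last exact: levelS.
  by rewrite IH mulmx0; apply: level_zero hx.
- rewrite mulmxDr -scalemxAr; case: k IHx IHy => [|k] IHx IHy.
    by rewrite IHx IHy scaler0 addr0.
  exact: level_comb.
Qed.

Lemma levels_scale c a x : levels c x -> levels c (a *: x).
Proof.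
elim=> [k y hy|y z _ IHy _ IHz]; first exact/levels_level/level_scale/hy.
by rewrite scalerDr; apply: levels_add.
Qed.

(** The sum of the levels contains [v] and is stable under each E_ab: it preserves, lowers or raises
    the level according to which of a, b equals c. *)
Lemma sub_gen_levels (c : 'I_n) x : sub_gen c x -> levels c x.
Proof.
elim=> [|a y z _ IHy _ IHz|a b y ca cb _ IH].
- exact/(@levels_level _ 0)/level0/sub_gen_v.
- by apply: levels_add => //; apply: levels_scale.
elim: IH => [k w hx|w z _ IHw _ IHz]; last first.
  by rewrite mulmxDr; apply: levels_add.
move: ca cb; rewrite leq_eqVlt => /predU1P[/val_inj <-|ca].
  rewrite leq_eqVlt => /predU1P[/val_inj <-|cb].
    by rewrite (level_Ecc hx); apply: levels_level; apply: level_scale hx.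
  have := level_raise cb hx; case: k hx => [|k] hx; last exact: levels_level.
  by move=> ->; apply: levels_level (level_zero hx).
rewrite leq_eqVlt => /predU1P[/val_inj <-|cb].
  by apply: levels_level; apply: levelS hx.
by apply: levels_level; apply: level_gl hx.
Qed.

Lemma level_vanish (c : 'I_n) N : (forall x, level c N x -> x = 0) ->
  forall k x, (N <= k)%N -> level c k x -> x = 0.
Proof.
move=> hN k x + hx; elim: hx => {k x} [x hx|j k x cj hx IH|e k x y _ IHx _ IHy] Nk.
- by apply: hN; move: Nk; rewrite leqn0 => /eqP ->; apply: level0.
- move: Nk; rewrite leq_eqVlt => /predU1P[eN|Nk]; last by rewrite IH ?mulmx0.
  by apply: hN; rewrite eN; apply: levelS.
- by rewrite IHx // IHy // scaler0 addr0.
Qed.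

Lemma levels_lower_nil (c j : 'I_n) N x : (c < j)%N ->
  (forall y, level c N y -> y = 0) -> levels c x -> E j c ^+ N *m x = 0.
Proof.
move=> cj hN; elim=> [k y hy|y z _ IHy _ IHz]; last by rewrite mulmxDr IHy IHz addr0.
have hl i : level c (k + i) (E j c ^+ i *m y).
  elim: i => [|i IH]; first by rewrite expr0 mul1mx addn0.
  by rewrite exprS -[_ * _]/(_ *m _) -mulmxA addnS; apply: levelS.
exact: level_vanish hN _ _ (leq_addl _ _) (hl N).
Qed.

Lemma levels_raise_nil (c j : 'I_n) N x : (c < j)%N ->
  (forall y, level c N y -> y = 0) -> levels c x -> E c j ^+ N *m x = 0.
Proof.
move=> cj hN; elim=> [k y hy|y z _ IHy _ IHz]; last by rewrite mulmxDr IHy IHz addr0.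
have [Nk|kN] := leqP N k; first by rewrite (level_vanish hN Nk hy) mulmx0.
have hl i m z : level c m z -> (m < i)%N -> E c j ^+ i *m z = 0.
  elim: i m z => [|i IH] m z hz //; rewrite ltnS => mi.
  rewrite exprSr -[_ * _]/(_ *m _) -mulmxA.
  have := level_raise cj hz; case: m hz mi => [|m] hz mi; last by move=> /IH; apply.
  by move=> ->; rewrite mulmx0.
exact: hl hy kN.
Qed.

Variable p : nat.
Hypothesis char_p : p \in [pchar F].
Hypothesis mu_dom : forall a b : 'I_n, (a <= b)%N -> mu b <= mu a.
Hypothesis v_weyl : forall i j : 'I_n, val j = (val i).+1 ->
  E j i ^+ (absz (mu i - mu j + 1)) *m v = 0.

(** * Vanishing of high levels, from the index [c1] down to [c] *)

Section Step.
Variables (c c1 : 'I_n) (N M : nat).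
Hypothesis c1E : val c1 = (val c).+1.
Hypothesis vanish1 : forall x, level c1 M x -> x = 0.
Hypothesis N_lt_p : (N < p)%N.
Hypothesis NE : N = (absz (mu c - mu c1)%R + M)%N.

Let cc1 : (c < c1)%N.
Proof. by rewrite [nat_of_ord c1]c1E. Qed.

Local Notation X := (E c1 c).

Let mulEmx (A B : 'M[F]_d.+1) (x : 'cV[F]_d.+1) : (A * B) *m x = A *m (B *m x).
Proof. by rewrite mulmxA. Qed.

Lemma lower_comm (j k : 'I_n) (x : 'cV[F]_d.+1) : (c < j)%N -> (c < k)%N ->
  E j c *m (E k c *m x) = E k c *m (E j c *m x).
Proof. by move=> cj ck; rewrite gl_act_comm ?(ltn_ord_eqF cj, ltn_ord_eqF ck). Qed.

(** The commutator of X and E_jc1 is -E_jc, which commutes with X. This lets one factor X be traded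
    for E_jc. *)
Lemma lowerX_step (j : 'I_n) r (x : 'cV[F]_d.+1) : (c1 < j)%N ->
  X ^+ r.+1 *m (E j c1 *m x)
  = E j c1 *m (X ^+ r.+1 *m x) - r.+1%:R *: (E j c *m (X ^+ r *m x)).
Proof.
move=> c1j; have cj := ltn_trans cc1 c1j.
have step (z : 'cV_d.+1) : X *m (E j c1 *m z) = E j c1 *m (X *m z) - E j c *m z.
  by rewrite gl_act (ltn_ord_eqF cj) eqxx scale0r scale1r addr0.
elim: r => [|r IH]; first by rewrite expr1 expr0 mul1mx scale1r step.
rewrite exprS !mulEmx IH mulmxBr step -scalemxAr lower_comm //.
have mulX s (z : 'cV_d.+1) : X *m (X ^+ s *m z) = X ^+ s.+1 *m z by rewrite exprS mulEmx.
by rewrite -[r.+2%:R]natr1 scalerDl scale1r !mulX; zmod.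
Qed.

(** On level 0 the Weyl relation at [v] suffices, since X commutes with gl on the indices above
    [c1]; by [lowerX_step] each further E_jc1 costs one more power of X. *)
Lemma level_lowerX k x : level c1 k x ->
  X ^+ (absz (mu c - mu c1 + 1)%R + k) *m x = 0.
Proof.
elim=> {k x} [x|j k x c1j hx IH|e k x y _ IHx _ IHy].
- elim=> [|a y z _ IHy _ IHz|a b y ca cb _ IH].
  + by rewrite addn0 v_weyl.
  + by rewrite mulmxDr -scalemxAr IHy IHz scaler0 addr0.
  + have comm r : X ^+ r *m (E a b *m y) = E a b *m (X ^+ r *m y).
      elim: r => [|r IHr]; first by rewrite expr0 !mul1mx.
      rewrite exprS !mulEmx IHr gl_act_comm ?(ltn_ord_eqF cb) //.
      by rewrite (ltn_ord_eqF (ltn_trans cc1 ca)).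
    by rewrite comm IH mulmx0.
- by rewrite addnS lowerX_step // exprS mulEmx IH !mulmx0 scaler0 subr0.
- by rewrite mulmxDr -scalemxAr IHx IHy scaler0 addr0.
Qed.

Lemma sub_gen_lowerX x : sub_gen c1 x -> X ^+ N *m x = 0.
Proof.
move=> /sub_gen_levels; elim=> [k y hy|y z _ IHy _ IHz].
  have [Mk|kM] := leqP M k; first by rewrite (level_vanish vanish1 Mk hy) mulmx0.
  pose m := absz (mu c - mu c1 + 1).
  (* From k < M it follows that [m + k] is at most [mu c - mu c1 + M], which is [N]. *)
  have hN : N = ((N - (m + k)) + (m + k))%N.
    by rewrite /m; have := @mu_dom c c1 (ltnW cc1); lia.
  by rewrite hN exprD mulEmx level_lowerX // mulmx0.
by rewrite mulmxDr IHy IHz addr0.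
Qed.

Definition lower (js : seq 'I_n) : 'M[F]_d.+1 := \prod_(j <- js) E j c.

Lemma lower_cons (j : 'I_n) js (x : 'cV[F]_d.+1) : lower (j :: js) *m x = E j c *m (lower js *m x).
Proof. by rewrite /lower big_cons mulEmx. Qed.

Lemma lower_commE (j : 'I_n) js (x : 'cV[F]_d.+1) : (c < j)%N -> all (fun k : 'I_n => c < k)%N js ->
  lower js *m (E j c *m x) = E j c *m (lower js *m x).
Proof.
move=> cj; elim: js => [|k js IH] /=; first by rewrite /lower big_nil !mul1mx.
by case/andP=> ck cjs; rewrite !lower_cons IH // lower_comm.
Qed.

Lemma lower_raise_comm (j : 'I_n) js (x : 'cV[F]_d.+1) : (c1 < j)%N ->
  all (fun k : 'I_n => c1 < k)%N js ->
  lower js *m (E j c1 *m x) = E j c1 *m (lower js *m x).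
Proof.
move=> cj; elim: js => [|k js IH] /=; first by rewrite /lower big_nil !mul1mx.
case/andP=> ck cjs; rewrite !lower_cons IH // gl_act_comm //.
  by rewrite (ltn_ord_eqF (ltn_trans cc1 cj)).
by rewrite (ltn_ord_eqF ck).
Qed.

Let all_lt_trans (js : seq 'I_n) :
  all (fun k : 'I_n => c1 < k)%N js -> all (fun k : 'I_n => c < k)%N js.
Proof. by apply: sub_all => k /=; apply: ltn_trans. Qed.

(** Polarization of X^N x = 0. Applied to E_jc1 x, the induction hypothesis kills both terms with
    X^(r+1) in [lowerX_step] and leaves r+1 times the desired vector; r+1 is at most N < p, hence
    invertible. *)
Lemma lower_lowerX ks r x : all (fun k : 'I_n => c1 < k)%N ks ->
  (size ks + r)%N = N -> sub_gen c1 x -> lower ks *m (X ^+ r *m x) = 0.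
Proof.
elim: ks r x => [|j ks IH] r x /=.
  by rewrite add0n => _ -> /sub_gen_lowerX hx; rewrite /lower big_nil mul1mx.
case/andP=> c1j c1ks szN hx; have cj := ltn_trans cc1 c1j.
rewrite addSn -addnS in szN.
have hjx : sub_gen c1 (E j c1 *m x) by apply: sub_gen_act => //; apply: ltnW.
have := IH r.+1 _ c1ks szN hjx.
rewrite lowerX_step // mulmxBr lower_raise_comm // (IH r.+1) // mulmx0 sub0r.
rewrite -scalemxAr lower_commE ?all_lt_trans // -lower_cons => /eqP.
rewrite oppr_eq0 scaler_eq0 => /orP[|/eqP //].
rewrite (negbTE (natr_neq0_char char_p _)) //= .
by move: N_lt_p; rewrite -szN; lia.
Qed.

(** The commuting factors of [js] are sorted one by one: those with j = c1 join the power of X, the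
    others join [ks]. *)
Lemma lower_lower js ks r x : all (fun k : 'I_n => c < k)%N js ->
  all (fun k : 'I_n => c1 < k)%N ks -> (size js + size ks + r)%N = N ->
  sub_gen c1 x -> lower js *m (lower ks *m (X ^+ r *m x)) = 0.
Proof.
elim: js ks r => [|j js IH] ks r /=.
  by move=> _ c1ks szN hx; rewrite {1}/lower big_nil mul1mx lower_lowerX.
case/andP=> cj cjs c1ks szN hx; rewrite lower_cons -lower_commE // -lower_commE ?all_lt_trans //.
move: (cj); rewrite -c1E leq_eqVlt => /predU1P[/val_inj jE|c1j].
  have -> : E j c *m (X ^+ r *m x) = X ^+ r.+1 *m x by rewrite -jE exprS mulEmx.
  by apply: IH => //; lia.
have := IH (j :: ks) r cjs; rewrite lower_cons /= c1j -szN => IHj.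
rewrite lower_commE ?all_lt_trans //.
by apply: IHj => //; lia.
Qed.

Lemma lower_level js k x : all (fun k : 'I_n => c < k)%N js ->
  level c k x -> (size js + k)%N = N -> lower js *m x = 0.
Proof.
move=> cjs hx; elim: hx js cjs => {k x} [x hx|j k x cj hx IH|e k x y _ IHx _ IHy] js cjs szN.
- have := @lower_lower js [::] 0 x cjs isT.
  rewrite /= expr0 mul1mx {2}/lower big_nil mul1mx; apply; first by rewrite addn0.
  by move: hx; rewrite -c1E.
- rewrite lower_commE // -lower_cons; apply: IH; rewrite /= ?cj // -szN; lia.
- by rewrite mulmxDr -scalemxAr IHx // IHy // scaler0 addr0.
Qed.

Lemma level_vanish_step x : level c N x -> x = 0.
Proof.
move=> hx; have := @lower_level [::] N x isT hx (add0n _).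
by rewrite /lower big_nil mul1mx.
Qed.

End Step.

Lemma level_last (l : 'I_n) k x : val l = n.-1 -> level l k x -> (0 < k)%N -> x = 0.
Proof.
move=> lE; elim=> {k x} // [j k x lj _ _ _|e k x y _ IHx _ IHy k0].
  by move: lj; rewrite [nat_of_ord l]lE ltnNge; have := ltn_ord j; lia.
by rewrite IHx // IHy // scaler0 addr0.
Qed.

(** Descending induction on c from the last index; the weight differences added at each step
    telescope. *)
Lemma level_vanish_all (c l : 'I_n) x : val l = n.-1 ->
  (absz (mu c - mu l)%R + 1 < p)%N ->
  level c (absz (mu c - mu l)%R + 1) x -> x = 0.
Proof.
move=> lE; have [m cm] := ubnP (l - c); elim: m c cm x => // m IH c cm x cp.
have cl : (c <= l)%N by rewrite [nat_of_ord l]lE; have := ltn_ord c; lia.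
have [cl1|lc] := ltnP c l; last first.
  have -> : c = l by apply: val_inj; apply/eqP; rewrite eqn_leq cl lc.
  by rewrite subrr add0n => /(level_last lE); apply.
have c1n : (c.+1 < n)%N by apply: leq_ltn_trans cl1 (ltn_ord l).
pose c1 := Ordinal c1n.
have d1 := @mu_dom c c1 (leqnSn _); have d2 := @mu_dom c1 l cl1.
apply: (@level_vanish_step c c1 _ (absz (mu c1 - mu l)%R + 1)) => //; last by lia.
by move=> y; apply: IH; [rewrite /=; lia | lia].
Qed.

End WeylModule.

(** * Invariant subspaces *)

Section Subspace.
Variables (F : fieldType) (d : nat) (P : 'cV[F]_d -> Prop).
Hypothesis P0 : P 0.
Hypothesis P_comb : forall a x y, P x -> P y -> P (a *: x + y).

(** A matrix with columns in P either spans P or, by excluded middle, can absorb a vector of P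
    outside its span; the rank then grows, but it cannot exceed d. *)
Lemma subspace_matrix : exists U : 'M[F]_d, forall y : 'cV[F]_d, colsub y U <-> P y.
Proof.
pose good (U : 'M[F]_d) := forall y : 'cV[F]_d, colsub y U -> P y.
have PD x y : P x -> P y -> P (x + y).
  by move=> hx hy; rewrite -[x]scale1r; apply: P_comb.
have PZ a x : P x -> P (a *: x).
  by move=> hx; rewrite -[_ *: _]addr0; apply: P_comb.
suff grow r : (exists U : 'M[F]_d, forall y : 'cV[F]_d, colsub y U <-> P y) \/
              exists2 U, good U & (r <= \rank U)%N.
  have [//|[U _]] := grow d.+1.
  by rewrite ltnNge rank_leq_row.
elim: r => [|r [|[U gU rU]]]; [|by left|].
  right; exists 0 => // y; rewrite /colsub trmx0 submx0 => /eqP y0.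
  by rewrite -[y]trmxK y0 trmx0.
have [[y Py yU]|full] := classic (exists2 y, P y & ~ colsub y U); last first.
  left; exists U => y; split; first exact: gU.
  by move=> Py; apply: NNPP => yU; apply: full; exists y.
right; exists (U^T + y^T)%MS^T.
  move=> z; rewrite /colsub trmxK => /sub_addsmxP[[a b] /= zE].
  have -> : z = (a *m U^T)^T + b 0 0 *: y.
    apply: trmx_inj; rewrite zE linearD /= trmxK linearZ /=; congr (_ + _).
    by rewrite [b]mx11_scalar mul_scalar_mx mxE eqxx mulr1n.
  apply: PD; last exact: PZ.
  by apply: gU; rewrite /colsub trmxK submxMl.
rewrite mxrank_tr; apply: leq_ltn_trans rU _.
rewrite -mxrank_tr; apply: rank_ltmx; rewrite ltmxE addsmxSl /=.
by apply/negP => /(submx_trans (addsmxSr _ _)).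
Qed.
End Subspace.

Lemma colsub_cols (F : fieldType) (d m k : nat) (A : 'M[F]_(d, m)) (B : 'M[F]_(d, k)) :
  (forall i, colsub (col i A) B) -> colsub A B.
Proof.
by move=> h; apply/row_subP => i; rewrite -tr_col; apply: h.
Qed.

Lemma colsub_mul (F : fieldType) (d m k : nat) (U : 'M[F]_(d, m)) (A : 'M[F]_(m, k)) :
  colsub (U *m A) U.
Proof. by rewrite /colsub trmx_mul submxMl. Qed.

Lemma subspace_invariant (F : fieldType) (d : nat) (P : 'cV[F]_d -> Prop)
    (U A : 'M[F]_d) :
  (forall y : 'cV[F]_d, colsub y U <-> P y) -> (forall y, P y -> P (A *m y)) ->
  colsub (A *m U) U.
Proof.
move=> UP PA; apply: colsub_cols => i.
by rewrite colE -mulmxA; apply/UP/PA/UP; apply: colsub_mul.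
Qed.

(** Irreducibility in the form of an induction principle: P cuts out a submodule containing the
    nonzero vector [xi]. *)
Lemma Yirreducible_ind (F : fieldType) (n d : nat)
    (T : 'I_n -> 'I_n -> nat -> 'M[F]_d) (P : 'cV[F]_d -> Prop) (xi : 'cV[F]_d) :
  Yirreducible T -> xi != 0 -> P xi ->
  (forall a x y, P x -> P y -> P (a *: x + y)) ->
  (forall i j r x, P x -> P (T i j r.+1 *m x)) -> forall y, P y.
Proof.
move=> [_ irr] xi0 Pxi Pcomb PT y.
have P0 : P 0 by rewrite -(addNr xi) -scaleN1r; apply: Pcomb.
have [U UP] := subspace_matrix P0 Pcomb.
have [|U0|Ud] := irr U.
- by move=> i j r; apply: subspace_invariant UP _ => x; apply: PT.
- case/eqP: xi0; have /UP := Pxi; rewrite /colsub.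
  move/eqP: U0; rewrite mxrank_eq0 => /eqP ->; rewrite trmx0 submx0 => /eqP h.
  by rewrite -[xi]trmxK h trmx0.
- by apply/UP/submx_full; rewrite /row_full mxrank_tr Ud.
Qed.

(** The vectors satisfying [sub_gen] at c = 0 form an invariant subspace containing [v], hence one
    that contains U. *)
Lemma weyl_sub_sub_gen (F : fieldType) (n d : nat) (E : 'I_n -> 'I_n -> 'M[F]_d.+1)
    (U : 'M[F]_d.+1) (mu : 'I_n -> int) :
  is_weyl_sub E U mu -> exists2 v, weyl_gen_rel E mu v &
    forall y : 'cV[F]_d.+1, colsub y U -> sub_gen E v 0 y.
Proof.
move=> [v [_ vrel vgen _]]; exists v => // y yU.
have comb := sub_gen_comb (E := E) (v := v) (c := 0%N).
have sv := sub_gen_v E v 0.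
have s0 : sub_gen E v 0 0 by rewrite -(addNr v) -scaleN1r; apply: comb.
have [W WP] := subspace_matrix s0 comb.
apply/WP; apply: submx_trans yU _; apply: vgen; last exact/WP.
by move=> i j; apply: subspace_invariant WP _ => x; apply: sub_gen_act.
Qed.

(** * Nilpotency of the root vectors in the first row and column *)

Section WeylSubNilpotent.
Variables (F : fieldType) (p n d : nat) (E : 'I_n -> 'I_n -> 'M[F]_d.+1).
Hypothesis char_p : p \in [pchar F].
Hypothesis glE : is_glrep E.
Variables (U : 'M[F]_d.+1) (mu : 'I_n -> int).
Hypothesis mu_dom : forall a b : 'I_n, (a <= b)%N -> mu b <= mu a.
Hypothesis mu_bound : forall a b : 'I_n, val a = 0%N -> val b = n.-1 ->
  mu a - mu b + n%:Z < p%:Z.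
Hypothesis weylU : is_weyl_sub E U mu.

Lemma weyl_sub_nil (i j : 'I_n) (y : 'cV[F]_d.+1) :
  val i = 0%N -> (i < j)%N -> colsub y U ->
  E i j ^+ p.-2 *m y = 0 /\ E j i ^+ p.-2 *m y = 0.
Proof.
move=> i0 ij yU; have [v [v1 [v2 v3]] vgen] := weyl_sub_sub_gen weylU.
have n0 : (n.-1 < n)%N by have := ltn_ord j; lia.
pose l := Ordinal n0; pose N := (absz (mu i - mu l)%R + 1)%N.
have := mu_bound i0 (erefl : val l = n.-1).
have n2 : (1 < n)%N by have := ltn_ord j; lia.
have d1 : mu l <= mu i by apply: mu_dom; rewrite [nat_of_ord i]i0.
(* Since n >= 2, the bound gives [mu i - mu l <= p - 3], which leaves room for the 1 in [N]. *)
move=> bnd; have Np : (N <= p.-2)%N by rewrite /N; lia.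
have Np' : (N < p)%N by rewrite /N; lia.
have v3' : forall a b : 'I_n, val b = (val a).+1 ->
    E b a ^+ (absz (mu a - mu b + 1)) *m v = 0.
  by move=> a b ab; rewrite -iter_mulmx v3.
have van x := @level_vanish_all F n d E glE mu v v1 v2 p char_p mu_dom v3' i l x
  (erefl _) Np'.
have lev : levels E v i y.
  by apply: sub_gen_levels => //; rewrite [nat_of_ord i]i0; apply: vgen.
have nil (A : 'M[F]_d.+1) : A ^+ N *m y = 0 -> A ^+ p.-2 *m y = 0.
  have -> : p.-2 = (p.-2 - N + N)%N by lia.
  by move=> h; rewrite exprD -mulmxE -mulmxA h mulmx0.
split; apply: nil; first exact: (levels_raise_nil glE v1 v2 ij van lev).
exact: (levels_lower_nil ij van lev).
Qed.
End WeylSubNilpotent.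

(** * Hilbert 90 for the shift *)

Lemma poly_ext_closed (F : closedFieldType) (f g : {poly F}) :
  (forall a, f.[a] = g.[a]) -> f = g.
Proof.
move=> h; apply/eqP; rewrite -subr_eq0; apply/negPn/negP => /closed_nonrootP[x].
by rewrite rootE hornerD hornerN h subrr eqxx.
Qed.

Section Norm.
Variables (F : closedFieldType) (p : nat).
Hypothesis char_p : p \in [pchar F].

(** The norm from F(u) to the field fixed by u -> u + 1, an automorphism of order p. *)
Definition shift_norm (f : {poly F}) : {poly F} :=
  \prod_(k < p) (f \Po ('X - k%:R%:P)).

Let p_gt0 : (0 < p)%N.
Proof. exact/prime_gt0/(pcharf_prime char_p). Qed.

Lemma shift_normM f g : shift_norm (f * g) = shift_norm f * shift_norm g.
Proof.
by rewrite /shift_norm -big_split; apply: eq_bigr => k _; rewrite rmorphM.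
Qed.

Lemma horner_shift_norm f a : (shift_norm f).[a] = \prod_(k < p) f.[a - k%:R].
Proof.
by rewrite /shift_norm horner_prod; apply: eq_bigr => k _; rewrite horner_comp !hornerE.
Qed.

Lemma shift_prod_horner f a k :
  shift_prod (fun c : F => f.[c]) a k = \prod_(i < k) f.[a - i%:R].
Proof.
elim: k a => [|k IH] a; first by rewrite big_ord0.
rewrite big_ord_recl subr0 /= IH; congr (_ * _); apply: eq_bigr => i _.
by rewrite /bump /= natrD opprD addrA.
Qed.

(** Replacing b by b - 1 rotates the p linear factors cyclically; the wrap-around uses p = 0 in
    F. *)
Lemma shift_norm_XsubC b k :
  shift_norm ('X - b%:P) = shift_norm ('X - (b - k%:R)%:P).
Proof.
elim: k => [|k ->]; first by rewrite subr0.
apply: poly_ext_closed => a; rewrite !horner_shift_norm.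
case: p p_gt0 char_p => // m _ hm.
rewrite big_ord_recr [in RHS]big_ord_recl mulrC; congr (_ * _).
  by apply: eq_bigr => i _; rewrite !hornerXsubC lift0 -[k.+1%:R]natr1 -[i.+1%:R]natr1; ring.
have : m.+1%:R = 0 :> F by rewrite pcharf0.
rewrite !hornerXsubC subr0 -[k.+1%:R]natr1 /= -natr1 => /eqP.
by rewrite addr_eq0 => /eqP ->; ring.
Qed.

Lemma shift_norm_root f b : root (shift_norm f) b -> exists k : nat, root f (b - k%:R).
Proof.
rewrite rootE horner_shift_norm => /prodf_eq0[k _ fk].
by exists k.
Qed.

Lemma root_shift_norm f b : root f b -> root (shift_norm f) b.
Proof.
move=> fb; rewrite rootE horner_shift_norm; apply/prodf_eq0.
by exists (Ordinal p_gt0) => //=; rewrite subr0.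
Qed.

Lemma shift_norm_neq0 f : f != 0 -> shift_norm f != 0.
Proof.
move=> f0; apply/prodf_neq0 => k _; rewrite comp_poly_eq0 // size_XsubC //.
Qed.

(* An explicit form of Hilbert 90 for the automorphism u -> u + 1 of F(u): each
   root of [g] is matched with a root of [f] in the same coset of the prime field. *)
Lemma hilbert90_shift (f g : {poly F}) : g != 0 -> lead_coef f = lead_coef g ->
  shift_norm f = shift_norm g ->
  exists2 P : {poly F}, P \is monic & f * P = g * (P \Po ('X + 1)).
Proof.
have [m] := ubnP (size g); elim: m f g => // m IH f g sg g0 lfg nfg.
have [/eqP sg1|/closed_rootP[b gb]] := eqVneq (size g) 1%N.
  have f1 : size f == 1%N.
    apply/negPn/negP => /closed_rootP[a /root_shift_norm].
    rewrite nfg => /shift_norm_root[k].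
    have /size_poly1P[c c0 ->] := sg1.
    by rewrite rootC (negbTE c0).
  exists 1; first exact: monic1.
  rewrite comp_polyC !mulr1.
  move/size_poly1P: f1 lfg => [c _ ->]; have /size_poly1P[e _ ->] := sg1.
  by rewrite !lead_coefC => ->.
have [k] : exists k, root f (b - k%:R).
  by apply: shift_norm_root; rewrite nfg root_shift_norm.
set a := b - k%:R => /factor_theorem[f' fE]; have /factor_theorem[g' gE] := gb.
have Xb0 : 'X - b%:P != 0 by rewrite polyXsubC_eq0.
have g'0 : g' != 0 by apply: contraNneq g0 => g'0; rewrite gE g'0 mul0r.
have [||||P' P'1 P'E] := IH f' g'.
- by move: sg; rewrite gE size_Mmonic ?monicXsubC // size_XsubC addn2 ltnS.
- exact: g'0.
- by move: lfg; rewrite fE gE !lead_coef_Mmonic ?monicXsubC.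
- move: nfg; rewrite fE gE !shift_normM -(shift_norm_XsubC b k).
  by apply: mulIf; apply: shift_norm_neq0.
(* The roots of Q interpolate between b and a = b - k, so both sides of [QE] are the product over
   the whole string b, b - 1, ..., b - k. *)
pose Q := \prod_(t < k) ('X - (b - t%:R)%:P).
have QE : ('X - a%:P) * Q = ('X - b%:P) * (Q \Po ('X + 1)).
  have -> : Q \Po ('X + 1) = \prod_(t < k) ('X - (b - t.+1%:R)%:P).
    rewrite /Q rmorph_prod; apply: eq_bigr => t _ /=.
    rewrite comp_polyB comp_polyX comp_polyC -[t.+1%:R]natr1 opprD addrA polyCB; ring.
  transitivity (\prod_(t < k.+1) ('X - (b - t%:R)%:P)).
    by rewrite big_ord_recr mulrC.
  by rewrite big_ord_recl subr0.
exists (P' * Q); first by rewrite monicMr // monic_prod_XsubC.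
rewrite comp_polyM fE gE mulrACA P'E QE; ring.
Qed.
End Norm.

(** * Linear recurrences and Laurent series *)

(** The first [#|J|.+1] vectors of F^J are linearly dependent; the coefficients of one dependency
    form q. *)
Lemma linear_recurrence (F : fieldType) (J : finType) (x : nat -> J -> F) :
  exists2 q : {poly F}, q != 0 & forall j, \sum_(r < size q) q`_r * x r j = 0.
Proof.
pose m := #|J|.
pose M := \matrix_(r < m.+1, c < m) x r (enum_val c).
have : kermx M != 0.
  by rewrite kermx_eq0 /row_free neq_ltn ltnS rank_leq_col.
case/rowV0Pn => w /sub_kermxP wM w0.
pose q := \poly_(r < m.+1) w 0 (inord r).
have qE (r : 'I_m.+1) : q`_r = w 0 r by rewrite coef_poly ltn_ord inord_val.
exists q => [|j].
  apply: contraNneq w0 => q0; apply/eqP/rowP => r.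
  by rewrite -qE q0 coef0 mxE.
have sq : (size q <= m.+1)%N by apply: size_poly.
have -> : \sum_(r < size q) q`_r * x r j = \sum_(r < m.+1) q`_r * x r j.
  rewrite (big_ord_widen m.+1 (fun r : nat => q`_r * x r j) sq) big_mkcond.
  apply: eq_bigr => r _; case: ltnP => // sr; by rewrite nth_default ?mul0r.
have := congr1 (fun A : 'rV_m => A 0 (enum_rank j)) wM; rewrite !mxE => wMj.
by rewrite -[RHS]wMj; apply: eq_bigr => r _; rewrite qE mxE enum_rankK.
Qed.

(** * Products of series in u^(-1) with polynomials *)

Section Laurent.
Variable F : fieldType.
Implicit Types (lam : nat -> F) (P Q : {poly F}) (e : int).

Definition lser_ext lam e : F := if e is Posz m then lam m else 0.

Lemma lser_poly_coefE lam P e N : (size P <= N)%N ->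
  lser_poly_coef lam P e = \sum_(k < N) P`_k * lser_ext lam (k%:Z - e).
Proof.
move=> sP; rewrite /lser_poly_coef.
rewrite (big_ord_widen_cond N (fun k : nat => e <= k%:Z)
  (fun k : nat => P`_k * lam (absz (k%:Z - e))) sP) big_mkcond.
apply: eq_bigr => k _; case: ifP => [/andP[ek kP]|].
  congr (_ * _); have : 0 <= k%:Z - e by rewrite subr_ge0.
  by case: (k%:Z - e).
case: ltnP => [kP|Pk] /=; last by rewrite nth_default ?mul0r.
rewrite andbT -subr_ge0.
by case: (k%:Z - e) => // m _; rewrite mulr0.
Qed.

Lemma lser_poly_coefD lam P Q e :
  lser_poly_coef lam (P + Q) e = lser_poly_coef lam P e + lser_poly_coef lam Q e.
Proof.
pose N := maxn (size P) (size Q).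
rewrite !(@lser_poly_coefE _ _ _ N) ?leq_maxl ?leq_maxr ?size_polyD //.
by rewrite -big_split; apply: eq_bigr => k _; rewrite coefD mulrDl.
Qed.

Lemma lser_poly_coefZ lam a P e :
  lser_poly_coef lam (a *: P) e = a * lser_poly_coef lam P e.
Proof.
rewrite !(@lser_poly_coefE _ _ _ (size P)) ?size_scale_leq // mulr_sumr.
by apply: eq_bigr => k _; rewrite coefZ mulrA.
Qed.

Lemma lser_poly_coef0 lam e : lser_poly_coef lam 0 e = 0.
Proof. by rewrite -[0](scale0r (0 : {poly F})) lser_poly_coefZ mul0r. Qed.

Lemma lser_poly_coefX lam P e :
  lser_poly_coef lam ('X * P) e = lser_poly_coef lam P (e - 1).
Proof.
rewrite (@lser_poly_coefE _ P _ (size P)) // (@lser_poly_coefE _ _ _ (size P).+1); last first.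
  by rewrite mulrC; apply: leq_trans (size_polyMleq _ _) _; rewrite size_polyX addn2.
rewrite big_ord_recl coefXM mul0r add0r; apply: eq_bigr => k _.
by rewrite coefXM lift0 /=; congr (_ * lser_ext _ _); lia.
Qed.

Lemma lser_poly_coefM lam P Q e : lser_poly_coef lam (P * Q) e
  = \sum_(k < size Q) Q`_k * lser_poly_coef lam P (e - k%:Z).
Proof.
have lXn k : lser_poly_coef lam ('X^k * P) e = lser_poly_coef lam P (e - k%:Z).
  elim: k e => [|k IH] e'; first by rewrite mul1r subr0.
  by rewrite exprS -mulrA lser_poly_coefX IH; congr lser_poly_coef; lia.
rewrite -{1}[Q]coefK poly_def mulr_sumr.
rewrite (big_morph (fun S => lser_poly_coef lam S e)
  (fun S S' => lser_poly_coefD lam S S' e) (lser_poly_coef0 lam e)).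
by apply: eq_bigr => k _; rewrite -scalerAr lser_poly_coefZ mulrC mulrC [P * _]mulrC lXn.
Qed.

(** Laurent series in u^(-1) have no zero divisors: the coefficients [y e] of the difference vanish
    for large e, and descending induction on e does the rest. *)
Lemma lser_poly_coef_cancel lam1 lam2 P1 P2 Q : Q != 0 ->
  (forall e, lser_poly_coef lam1 (P1 * Q) e = lser_poly_coef lam2 (P2 * Q) e) ->
  forall e, lser_poly_coef lam1 P1 e = lser_poly_coef lam2 P2 e.
Proof.
move=> Q0 h e0; pose y e := lser_poly_coef lam1 P1 e - lser_poly_coef lam2 P2 e.
have hy e : \sum_(k < size Q) Q`_k * y (e - k%:Z) = 0.
  under eq_bigr do rewrite mulrBr.
  by rewrite sumrB -!lser_poly_coefM h subrr.
pose B : int := (size P1 + size P2)%N%:Z.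
have y_top e : B <= e -> y e = 0.
  move=> Be; rewrite /y !(@lser_poly_coefE _ _ _ (size P1 + size P2)) ?leq_addr ?leq_addl //.
  have ext0 lam (k : 'I_(size P1 + size P2)) : lser_ext lam (k%:Z - e) = 0.
    have : k%:Z - e < 0 by have := ltn_ord k; lia.
    by case: (k%:Z - e).
  by rewrite !big1 ?subrr // => k _; rewrite ext0 mulr0.
suff ally m e : B - m%:Z <= e -> y e = 0.
  apply/eqP; rewrite -subr_eq0; apply/eqP.
  apply: (ally (absz (B - e0)%R)); clearbody B; lia.
elim: m e => [|m IH] e Be; first by apply: y_top; lia.
have [s sQ] : exists s, size Q = s.+1.
  by exists (size Q).-1; rewrite prednK // size_poly_gt0.
(* At exponent e + deg Q every term but that of the leading coefficient of Q involves some [y] at an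
   exponent above e, already known to vanish. *)
have := hy (e + s%:Z); rewrite sQ big_ord_recr /= addrK big1 ?add0r; last first.
  by move=> k _; rewrite IH ?mulr0 //; have := ltn_ord k; lia.
have /negPf lQ : Q`_s != 0 by rewrite -[s]/(s.+1.-1) -sQ lead_coef_eq0.
by move/eqP; rewrite mulf_eq0 lQ => /eqP.
Qed.

(* The last hypothesis says that lam1(u) f(v) - lam2(u) g(v) is equal to
   (v - u) * sum_s h_s(v) u^(-s); the conclusion is obtained at v = u. *)
Lemma lser_poly_coef_telescope lam1 lam2 f g (h : nat -> {poly F}) m :
  h 0%N = 0 -> (forall s, size (h s) <= m)%N ->
  (forall s, 'X * h s - h s.+1 = lam1 s *: f - lam2 s *: g) ->
  forall e, lser_poly_coef lam1 f e = lser_poly_coef lam2 g e.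
Proof.
move=> h0 hm hfg e; pose N := (size f + size g + m).+1.
pose G (z : int) : {poly F} := if z is Posz s then h s else 0.
(* The summands become [c k - c k.+1]. The sum telescopes between [c 0 = 0] and [c N], which
   vanishes because N - 1 is at least the size bound m. *)
pose c (k : nat) := if k is k'.+1 then (G (k%:Z - e))`_k' else 0.
apply/eqP; rewrite -subr_eq0; apply/eqP.
have fN : (size f <= N)%N by rewrite /N; lia.
have gN : (size g <= N)%N by rewrite /N; lia.
rewrite (lser_poly_coefE lam1 e fN) (lser_poly_coefE lam2 e gN) -sumrB.
have term (k : 'I_N) : f`_k * lser_ext lam1 (k%:Z - e) - g`_k * lser_ext lam2 (k%:Z - e)
    = c k - c k.+1.
  have -> : c k = ('X * G (k%:Z - e))`_k by rewrite coefXM; case: (nat_of_ord k).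
  have -> : c k.+1 = (G (k%:Z - e + 1))`_k by rewrite /c; congr ((G _)`_k); lia.
  case: (k%:Z - e) => [s|s].
    have := congr1 (fun r : {poly F} => r`_k) (hfg s).
    rewrite !coefB !coefZ [lam1 s * _]mulrC [lam2 s * _]mulrC => <-.
    by have -> : Posz s + 1 = Posz s.+1 by lia.
  have -> : G (Negz s + 1) = 0 by case: s => //= ; rewrite h0.
  by rewrite /lser_ext /G !mulr0 coef0.
rewrite (eq_bigr _ (fun k _ => term k)) -(big_mkord xpredT (fun k => c k - c k.+1)).
rewrite (@telescope_sumr_eq _ _ _ (fun k => - c k)) //; last first.
  by move=> k _; rewrite opprK addrC.
have -> : c N = 0; last by rewrite /= oppr0 subrr.
rewrite /c /N; apply: nth_default; rewrite /G.
case: (_ - e) => [s|s]; last by rewrite size_poly0.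
by apply: leq_trans (hm s) (leq_addl _ _).
Qed.
End Laurent.

(** * Highest weights *)


Lemma shift_prod_eigen (F : fieldType) (d : nat) (V : F -> 'M[F]_d.+1) (th : F -> F)
    (xi : 'cV[F]_d.+1) a k :
  (forall c, V c *m xi = th c *: xi) ->
  shift_prod V a k *m xi = shift_prod th a k *: xi.
Proof.
move=> Vxi; elim: k a => [|k IH] a /=; first by rewrite mul1mx scale1r.
by rewrite -mulmxE -mulmxA IH -scalemxAr Vxi scalerA mulrC.
Qed.

Section HighestWeight.
Variables (F : closedFieldType) (n d : nat).
Variable T : 'I_n -> 'I_n -> nat -> 'M[F]_d.+1.
Hypothesis hY : is_Yrep T.

Let t : 'I_n -> 'I_n -> nat -> 'M[F]_d.+1 := tY T.

Lemma tY0 i j : t i j 0 = (i == j)%:R.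
Proof. by rewrite /t /=; case: (i == j); rewrite ?scalar_mx_is_scalar // raddf0. Qed.

Lemma tY_rel : yangian_rel t.
Proof. by move=> i j k l r s; apply: hY. Qed.

Lemma tY_gl : is_glrep (fun a b => T a b 1%N).
Proof.
move=> i j k l; have := tY_rel i j k l 0 1.
rewrite (t0_comm tY0) subrr subr0 !tY0 /= => ->.
by congr (_ - _); rewrite ?mulr_natr ?mulr_natl scaler_nat // eq_sym.
Qed.

Lemma tY_recurrence : exists2 q : {poly F}, q != 0 &
  forall i j, \sum_(r < size q) q`_r *: t i j r.+1 = 0.
Proof.
have [q q0 hq] := @linear_recurrence F ('I_n * 'I_n * ('I_d.+1 * 'I_d.+1))%type
  (fun r x => T x.1.1 x.1.2 r.+1 x.2.1 x.2.2).
exists q => // i j; apply/matrixP => a b; rewrite summxE mxE.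
rewrite -[RHS](hq ((i, j), (a, b))).
by apply: eq_bigr => r _; rewrite mxE.
Qed.

Variables (lam : 'I_n -> nat -> F) (xi : 'cV[F]_d.+1).
Hypothesis lam0 : forall i, lam i 0%N = 1.
Hypothesis hw : Yhw_vector T lam xi.
Variable q : {poly F}.
Hypothesis q_neq0 : q != 0.
Hypothesis q_rel : forall i j, \sum_(r < size q) q`_r *: t i j r.+1 = 0.

Definition hw_poly i : {poly F} := \sum_(r < size q) lam i r *: drop_poly r q.

(** Only the term r = 0 has full degree; it is q itself because [lam i 0] is 1. *)
Lemma lead_coef_hw_poly i : lead_coef (hw_poly i) = lead_coef q.
Proof.
rewrite /hw_poly.
have [m sq] : exists m, size q = m.+1.
  by exists (size q).-1; rewrite prednK // size_poly_gt0.
rewrite -(big_mkord xpredT (fun r => lam i r *: drop_poly r q)) {1}sq big_nat_recl //.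
rewrite lam0 scale1r drop_poly0l big_mkord lead_coefDl //.
rewrite sq ltnS; apply: leq_trans (size_sum _ _ _) _; apply/bigmax_leqP => r _.
apply: leq_trans (size_scale_leq _ _) _.
by rewrite size_drop_poly sq subSS leq_subr.
Qed.

Lemma hw_poly_neq0 i : hw_poly i != 0.
Proof. by rewrite -lead_coef_eq0 lead_coef_hw_poly lead_coef_eq0. Qed.

Lemma tY_hw i s : t i i s *m xi = lam i s *: xi.
Proof.
case: s => [|s]; last by have [_ /(_ s)[_ ->]] := hw.
by rewrite tY0 eqxx lam0 mul1mx scale1r.
Qed.

Lemma current_hw i a : current t q i i a *m xi = (hw_poly i).[a] *: xi.
Proof.
rewrite /current mulmx_suml /hw_poly horner_sum scaler_suml.
apply: eq_bigr => r _.
by rewrite -scalemxAl tY_hw scalerA hornerZ mulrC.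
Qed.

Lemma current_hw_up (i j : 'I_n) a : (i < j)%N -> current t q i j a *m xi = 0.
Proof.
move=> ij; rewrite /current mulmx_suml big1 // => r _; rewrite -scalemxAl.
case: (nat_of_ord r) => [|s].
  by rewrite tY0 (ltn_ord_eqF ij) mul0mx scaler0.
by have [_ /(_ s)[/(_ _ _ ij)]] := hw; rewrite /t /= => -> _; rewrite scaler0.
Qed.

(** The mixed relation between Th_ij(a) and t_ji^(s), evaluated on [xi]: its right side involves
    only diagonal operators, and its left side telescopes in s. *)
Lemma lser_hw_poly i j : i != j -> forall e,
  lser_poly_coef (lam i) (hw_poly j) e = lser_poly_coef (lam j) (hw_poly i) e.
Proof.
move=> ne_ij.
have [xi0 _] := hw; have /cV0Pn[i0 xii0] := xi0.
(* A linear functional that returns the eigenvalue of any operator having [xi] as an eigenvector. *)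
pose phi (A : 'M[F]_d.+1) : F := (A *m xi) i0 0 / xi i0 0.
have phiB A B : phi (A - B) = phi A - phi B.
  by rewrite /phi mulmxBl [X in X / _]mxE [X in (_ + X) / _]mxE mulrBl.
have phiZ a A : phi (a *: A) = a * phi A.
  by rewrite /phi -scalemxAl mxE mulrA.
pose h s := \sum_(r < size q) phi (t i j r * t j i s - t j i s * t i j r) *: drop_poly r q.
have hE s a : (h s).[a] = phi (current t q i j a * t j i s - t j i s * current t q i j a).
  rewrite /h horner_sum /current mulr_suml mulr_sumr -sumrB.
  have phi0 : phi 0 = 0 by rewrite -(subrr 0) phiB subrr.
  have phiD A B : phi (A + B) = phi A + phi B.
    by rewrite -[B in LHS]opprK phiB -[- B]sub0r phiB phi0 sub0r opprK.
  rewrite (big_morph phi phiD phi0); apply: eq_bigr => r _.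
  by rewrite hornerZ -scalerAl -scalerAr -scalerBr phiZ mulrC.
apply: (@lser_poly_coef_telescope _ _ _ _ _ h (size q)).
- rewrite /h big1 // => r _; rewrite (tY0 j i) eq_sym (negbTE ne_ij).
  by rewrite mulr0 mul0r subrr /phi mul0mx mxE mul0r scale0r.
- move=> s; apply: leq_trans (size_sum _ _ _) _; apply/bigmax_leqP => r _.
  apply: leq_trans (size_scale_leq _ _) _.
  by rewrite size_drop_poly leq_subr.
move=> s; apply: poly_ext_closed => a; rewrite !hornerE !hE -phiZ -phiB.
rewrite (current_mixed tY0 tY_rel q_rel) phiB.
have phi_eig A B x y : A *m xi = x *: xi -> B *m xi = y *: xi -> phi (A * B) = x * y.
  move=> hA hB; rewrite /phi -mulmxE -mulmxA hB -scalemxAr hA scalerA mxE.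
  by rewrite mulfK // mulrC.
by rewrite !(phi_eig _ _ _ _ (current_hw _ _) (tY_hw _ _))
           !(phi_eig _ _ _ _ (tY_hw _ _) (current_hw _ _)) mulrC.
Qed.

Variable p : nat.
Hypothesis char_p : p \in [pchar F].
Hypothesis p_gt2 : (2 < p)%N.
Hypothesis irr : Yirreducible T.

(** A central operator keeps on the whole module the eigenvalue it has at [xi], because [xi]
    generates an irreducible module. *)
Lemma falling_scalar i a :
  falling t q i a p = (shift_norm p (hw_poly i)).[a] *: 1.
Proof.
rewrite horner_shift_norm -shift_prod_horner.
set b := shift_prod (fun c : F => (hw_poly i).[c]) a p; have [xi0 _] := hw.
have E : forall y : 'cV_d.+1, falling t q i a p *m y = b *: y.
  apply: (Yirreducible_ind (P := fun y => falling t q i a p *m y = b *: y) irr xi0).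
  - exact: (shift_prod_eigen _ _ (current_hw i)).
  - by move=> c x y hx hy; rewrite mulmxDr -scalemxAr hx hy scalerDr !scalerA mulrC.
  - move=> k l r x hx; rewrite mulmxA mulmxE.
    have -> := falling_central tY0 tY_rel q_rel char_p i k l r.+1 a.
    by rewrite -mulmxE -mulmxA hx -scalemxAr.
apply/matrixP => k l; have := congr1 (fun v : 'cV_d.+1 => v k 0) (E (delta_mx l 0)).
by rewrite -colE !mxE => ->; rewrite eqxx andbT.
Qed.

(** Conjugation leaves the scalar product for i unchanged and rewrites it as the product of the
    Th_ij + Th_jj, whose eigenvalue at [xi] is the norm for j. *)
Lemma shift_norm_hw_poly (i j : 'I_n) : (i < j)%N ->
  T i j 1%N ^+ p.-2 = 0 -> T j i 1%N ^+ p.-2 = 0 ->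
  shift_norm p (hw_poly i) = shift_norm p (hw_poly j).
Proof.
move=> ij e_nil f_nil; apply: poly_ext_closed => a.
have ne_ij : i != j by rewrite (ltn_ord_eqF ij).
have [G [G' [GG' Gc]]] := weyl_conj tY0 tY_rel q char_p ne_ij p_gt2 e_nil f_nil.
pose V c := current t q i j c + current t q j j c.
have := shift_prod_conj a p Gc; rewrite -/V falling_scalar.
move=> /(congr1 (fun x => x * G')); rewrite -scalerAr mulr1 -scalerAl -!mulrA GG' mulr1.
move=> /(congr1 (fun x => x *m xi)).
rewrite -scalemxAl mul1mx (@shift_prod_eigen _ _ V (fun c => (hw_poly j).[c])); last first.
  by move=> c; rewrite mulmxDl current_hw_up // add0r current_hw.
rewrite shift_prod_horner -horner_shift_norm.
move=> /eqP; rewrite -subr_eq0 -scalerBl scaler_eq0; have [/negbTE -> _] := hw.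
by rewrite orbF subr_eq0 => /eqP.
Qed.

End HighestWeight.

(** * Ratios of consecutive highest weight series *)

Lemma sum_colspaces_nil (F : fieldType) (d k N : nat) (U : 'I_k -> 'M[F]_d.+1)
    (A : 'M[F]_d.+1) :
  (\sum_j (U j)^T :=: 1%:M)%MS ->
  (forall j (y : 'cV[F]_d.+1), colsub y (U j) -> A ^+ N *m y = 0) -> A ^+ N = 0.
Proof.
move=> sumU hA.
have E (y : 'cV[F]_d.+1) : A ^+ N *m y = 0.
  have : (y^T <= \sum_j (U j)^T)%MS by rewrite sumU submx1.
  case/sub_sumsmxP => u yE; rewrite -[y]trmxK yE linear_sum mulmx_sumr /= big1 // => j _.
  by apply: (hA j); rewrite /colsub trmxK submxMl.
apply/matrixP => a b; have := congr1 (fun v : 'cV_d.+1 => v a 0) (E (delta_mx b 0)).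
by rewrite -colE !mxE.
Qed.

Theorem theorem3p2p5
  (F : closedFieldType) (p : nat) (hp : prime p) (hchar : p \in [pchar F])
  (halg : forall x : F, exists q : {poly F},
      [/\ q != 0, root q x & forall m : nat, exists c : nat, q`_m = c%:R])
  (n : nat) (hn : (0 < n)%N)
  (d : nat) (T : 'I_n -> 'I_n -> nat -> 'M[F]_d)
  (hY : is_Yrep T) (hirr : Yirreducible T)
  (k : nat) (mu : 'I_k -> 'I_n -> int)
  (hdom : forall (j : 'I_k) (a b : 'I_n), (a <= b)%N -> mu j b <= mu j a)
  (hbound : forall (j : 'I_k) (a b : 'I_n), val a = 0%N -> val b = n.-1 ->
      mu j a - mu j b + (n%:Z) < p%:Z)
  (hdec : exists U : 'I_k -> 'M[F]_d,
      [/\ forall j, glinvariant (fun a b => T a b 1%N) (U j),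
          forall j, is_weyl_sub (fun a b => T a b 1%N) (U j) (mu j),
          (\sum_j \rank (U j))%N = d &
          (\sum_j (U j)^T :=: 1%:M)%MS])
  (lam : 'I_n -> nat -> F) (hlam0 : forall i, lam i 0%N = 1)
  (hL : exists xi : 'cV[F]_d, Yhw_vector T lam xi) :
  exists P : 'I_n -> {poly F},
    forall i j : 'I_n, val j = (val i).+1 ->
      P i \is monic /\
      forall e : int,
        lser_poly_coef (lam i) (P i) e = lser_poly_coef (lam j) (P i \Po ('X + 1)) e.
Proof.
case: d T hY hirr hdec hL => [|d] T hY irr; first by case: irr.
move=> [U [_ Uweyl Urank Usum]] [xi hw].
suff H (i j : 'I_n) : val j = (val i).+1 -> exists P : {poly F}, P \is monic /\
    forall e, lser_poly_coef (lam i) P e = lser_poly_coef (lam j) (P \Po ('X + 1)) e.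
  have [i|P hP] := @fin_all_exists _ _ (fun i (P : {poly F}) => forall j : 'I_n,
      val j = (val i).+1 -> P \is monic /\ forall e,
      lser_poly_coef (lam i) P e = lser_poly_coef (lam j) (P \Po ('X + 1)) e); last by exists P.
  case: (ltnP i.+1 n) => [lt_in|le_ni].
    have [P hP] := H i (Ordinal lt_in) erefl; exists P => j jE.
    by have -> : j = Ordinal lt_in by apply: val_inj.
  (* The last index has no successor, so any polynomial serves. *)
  exists 1 => j jE; have := ltn_ord j; rewrite -[nat_of_ord j]/(val j) jE.
  by rewrite ltnNge le_ni.
move=> ij1.
have [q q0 q_rel] := tY_recurrence T.
have n2 : (1 < n)%N by have := ltn_ord j; rewrite -[nat_of_ord j]/(val j) ij1; lia.
(* The ranks add up to [d.+1], so some summand exists; its bound gives p > n >= 2. *)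
have p2 : (2 < p)%N.
  case: k mu hdom hbound U Uweyl Urank Usum => [|k] mu hdom hbound U _ Urank _.
    by move: Urank; rewrite big_ord0.
  have nl : (n.-1 < n)%N by lia.
  have := hbound ord0 (Ordinal hn) (Ordinal nl) erefl erefl.
  by have := hdom ord0 (Ordinal hn) (Ordinal nl) (leq0n _); lia.
(* All norms are compared with that of the first index, since [weyl_sub_nil] covers the root vectors
   joining it to any other index. *)
have norm0 (j0 : 'I_n) :
    shift_norm p (hw_poly lam q (Ordinal hn)) = shift_norm p (hw_poly lam q j0).
  have [->//|ne_j0] := eqVneq j0 (Ordinal hn).
  have lt_j0 : (Ordinal hn < j0)%N.
    by rewrite lt0n; apply: contraNneq ne_j0 => j00; apply/eqP/val_inj.
  have nil s (y : 'cV_d.+1) : colsub y (U s) ->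
     T (Ordinal hn) j0 1%N ^+ p.-2 *m y = 0 /\ T j0 (Ordinal hn) 1%N ^+ p.-2 *m y = 0.
    move=> yU.
    have v0 : val (Ordinal hn) = 0%N by [].
    exact: (weyl_sub_nil hchar (tY_gl hY) (hdom s) (hbound s) (Uweyl s) v0 lt_j0 yU).
  apply: (shift_norm_hw_poly hY hlam0 hw q_rel hchar p2 irr lt_j0).
    by apply: (sum_colspaces_nil Usum) => s y /nil[].
  by apply: (sum_colspaces_nil Usum) => s y /nil[].
have lead i' := lead_coef_hw_poly hlam0 q0 i'.
have [] := @hilbert90_shift F p hchar (hw_poly lam q i) (hw_poly lam q j).
- exact: hw_poly_neq0.
- by rewrite !lead.
- by rewrite -!norm0.
move=> P P1 PE; exists P; split=> //.
(* Writing theta for [hw_poly]: lambda_i P theta_j = lambda_j P theta_i = lambda_j theta_j P(u+1),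
   and the nonzero theta_j cancels. *)
apply: (@lser_poly_coef_cancel _ _ _ _ _ (hw_poly lam q j)); first exact: hw_poly_neq0.
move=> e.
have ne_ij : i != j by rewrite -val_eqE ij1 neq_ltn leqnn.
have lserE := lser_hw_poly hY hlam0 hw q_rel ne_ij.
rewrite (mulrC P) (lser_poly_coefM (lam i)); under eq_bigr do rewrite lserE.
by rewrite -lser_poly_coefM PE mulrC.
Qed.
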